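(* Let $R=k[x_1,\ldots,x_n]$ ($n\ge 2$) be a polynomial ring over a field $k$ with homogeneous maximal ideal $\mathfrak m$, and let $f_1,f_2$ be a homogeneous regular sequence in $R$ of degrees $d_1\ge d_2$. Let $d\ge d_1$ be an integer, put $a_i=d-d_i$, $\delta=d_1+d_2-d$, $M=\mathfrak m^{a_1}\oplus\mathfrak m^{a_2}$, and $I=(f_1,f_2)_{\ge d}=\mathfrak m^{a_1}f_1+\mathfrak m^{a_2}f_2$. Let $\mathcal A$ be the kernel of $\chi:S\to\mathcal R(I)$, and let $h_1,\ldots,h_t$, $C$ and $L$ be as defined in the context. Then $$x_1^{\delta}\mathcal A\mathcal R(M)=(h_1,\ldots,h_t)L^{(\delta)}$$ as ideals of $\mathcal R(M)$. In particular: (1) If $d_1\le d\le d_1+d_2-1$, then the $\mathcal R(M)$-ideals $x_1^{\delta}\mathcal A\mathcal R(M)$ and $h_1L^{(\delta)}$ are equal and the bigraded $\mathcal R(M)$-modules $\mathcal A\mathcal R(M)$ and $L^{(\delta)}(0,-1)$ are isomorphic. (2) If $d\ge d_1+d_2$, then $\mathcal R(I)=S/(I_2(C),h_1,\ldots,h_t)$, i.e. $\mathcal A=I_2(C)+(h_1,\ldots,h_t)$.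
   Context: For an integer $a\ge 0$ let $\mathcal J_a$ be the set of multi-indices $\underline j=(j_{n-1},\ldots,j_1)$ of integers with $0\le j_1\le\cdots\le j_{n-1}\le a$, and let $\mathcal J'_a$ be the subset of those with $1\le j_1$ (so $\mathcal J'_0=\emptyset$). For $\underline j\in\mathcal J_a$ put $\underline x^{a,\underline j}=\prod_{i=1}^n x_i^{j_i-j_{i-1}}$, where $j_0=0$, $j_n=a$ (these are the monomials of degree $a$). $\mathcal R(M)=R[\{\underline x^{a_l,\underline j}t_l : l=1,2,\ \underline j\in\mathcal J_{a_l}\}]\subset R[t_1,t_2]$ is the Rees algebra of $M$, and $\mathcal R(I)=R[It]\subset R[t]$ is the Rees algebra of $I$. Let $T=k[T_{l,\underline j} : l=1,2,\ \underline j\in\mathcal J_{a_l}]$ and $S=T[x_1,\ldots,x_n]$ be polynomial rings, $S$ being bigraded with $\deg x_i=(1,0)$ and $\deg T_{l,\underline j}=(0,1)$. Let $\phi:S\to\mathcal R(M)$ be the $R$-algebra epimorphism with $\phi(T_{l,\underline j})=\underline x^{a_l,\underline j}t_l$, let $\Psi:\mathcal R(M)\to\mathcal R(I)$ be the natural $R$-algebra epimorphism with $\Psi(ut_l)=uf_lt$ for $u\in\mathfrak m^{a_l}$, and let $\chi=\Psi\circ\phi$. $\mathcal R(M)$ carries the bigrading induced from $S$ via $\phi$; elements and ideals of $S$ are viewed in $\mathcal R(M)$ via $\phi$, so $\mathcal A\mathcal R(M)=\phi(\mathcal A)$. For $\underline j\in\mathcal J'_{a_l}$ and $1\le s\le n$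 let $T_{l,\underline j,s}$ denote the variable $T_{l,(j_{n-1},\ldots,j_s,\,j_{s-1}-1,\ldots,j_1-1)}$. Let $C$ be the matrix with $n$ rows whose first column is $(x_1,\ldots,x_n)^{\rm tr}$ and whose remaining columns are indexed by the pairs $(l,\underline j)$, $l=1,2$, $\underline j\in\mathcal J'_{a_l}$, ordered lexicographically, with entry $T_{l,\underline j,s}$ in row $s$ and column $(l,\underline j)$. $I_2(C)$ is the $S$-ideal generated by the $2\times2$ minors of $C$. $L$ is the (prime) ideal of $\mathcal R(M)$ generated by the images of all the variables appearing in the first row of $C$. For $\delta\ge1$, $L^{(\delta)}=L^{\delta}\mathcal R(M)_L\cap\mathcal R(M)$ is the $\delta$-th symbolic power. Convention: the (symbolic) power of any element or ideal with nonpositive exponent is one or the unit ideal, respectively. Definition of $h_1,\ldots,h_t\in S$. If $d_1\le d\le d_1+d_2$, then $t=1$: write $f_2=\sum_{\underline k\in\mathcal J_{a_1}}c_{\underline k}\,\underline x^{a_1,\underline k}$ and $f_1=\sum_{\underline k\in\mathcal J_{a_2}}b_{\underline k}\,\underline x^{a_2,\underline k}$ with $c_{\underline k},b_{\underline k}\in R$ homogeneous of degree $\delta$ (any fixed choice) and set $h_1=-\sum_{\underline k}c_{\underline k}T_{1,\underline k}+\sum_{\underline k}b_{\underline k}T_{2,\underline k}$, which has bidegree $(\delta,1)$. If $d\ge d_1+d_2$, then for each monomial $m$ of degree $d-d_1-d_2$ write $mf_2=\sum_{\underline k\in\mathcal J_{a_1}}c_{\underline k}\,\underline x^{a_1,\underline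 k}$ and $mf_1=\sum_{\underline k\in\mathcal J_{a_2}}b_{\underline k}\,\underline x^{a_2,\underline k}$ with $c_{\underline k},b_{\underline k}\in k$; the linear forms $-\sum_{\underline k}c_{\underline k}T_{1,\underline k}+\sum_{\underline k}b_{\underline k}T_{2,\underline k}$ so obtained are $h_1,\ldots,h_t$, with $t=\binom{d-d_1-d_2+n-1}{n-1}$. (For $d=d_1+d_2$ the two descriptions agree.) *)

(* Defs.v *)
From HB Require Import structures.
From mathcomp Require Import all_boot all_order all_algebra.
From mathcomp Require Import fraction.
From mathcomp Require Export mpoly.

Set Implicit Arguments.
Unset Strict Implicit.
Unset Printing Implicit Defensive.

Import Order.TTheory GRing.Theory.
Local Open Scope ring_scope.

(* Subrings and ideals are Prop-valued predicates. In this section B is a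
   subring of an ambient commutative ring A, and an "ideal of B" is a predicate
   on A all of whose elements satisfy B. *)
Section Ideals.
Variables (A : comNzRingType) (B : A -> Prop).
Implicit Types (U V : A -> Prop).

Definition ideal_gen (G : A -> Prop) (y : A) : Prop :=
  exists2 s : seq (A * A),
    forall p, p \in s -> B p.1 /\ G p.2 & y = \sum_(p <- s) p.1 * p.2.

Definition ideal_mul U V : A -> Prop :=
  ideal_gen (fun y => exists u v, [/\ U u, V v & y = u * v]).

Fixpoint ideal_exp U (e : nat) : A -> Prop :=
  if e is e'.+1 then ideal_mul U (ideal_exp U e') else B.

Definition elt_mul (r : A) U (y : A) : Prop := exists2 u, U u & y = r * u.

End Ideals.

Definition whole (A : Type) (_ : A) : Prop := True.

Definition image_of (A A' : Type) (g : A -> A') (U : A -> Prop) (y : A') : Prop :=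
  exists2 u, U u & y = g u.

(* r_1, ..., r_m is regular if each r_i is a nonzerodivisor modulo the previous
   ones and (r_1, ..., r_m) is a proper ideal. *)
Definition regular_sequence (A : comNzRingType) (s : seq A) : Prop :=
  (forall i, (i < size s)%N -> forall g,
     ideal_gen (@whole A) (fun y => y \in take i s) (s`_i * g) ->
     ideal_gen (@whole A) (fun y => y \in take i s) g)
  /\ ~ ideal_gen (@whole A) (fun y => y \in s) 1.

(* B_P = {r / s : r in B, s in B \ P} inside the fraction field of the ambient
   domain, and P^(e) = P^e B_P \cap B. For e = 0 this is the unit ideal. *)
Definition localization (A : idomainType) (B P : A -> Prop)
    (q : {fraction A}) : Prop :=
  exists r s, [/\ B r, B s, ~ P s & q = tofrac r / tofrac s].

Definition symbolic_power (A : idomainType) (B P : A -> Prop) (e : nat)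
    (y : A) : Prop :=
  B y /\
  ideal_gen (localization B P) (image_of (@tofrac A) (ideal_exp B P e))
    (tofrac y).

(* The subalgebra R[G] of an R-algebra. *)
Inductive adjoin (R : comNzRingType) (A : lalgType R) (G : A -> Prop) :
    A -> Prop :=
| adjoin_scalar c : adjoin G c%:A
| adjoin_gen y of G y : adjoin G y
| adjoin_add y z of adjoin G y & adjoin G z : adjoin G (y + z)
| adjoin_mul y z of adjoin G y & adjoin G z : adjoin G (y * z).

Definition is_minor (A : comNzRingType) (r p q : nat) (M : 'M[A]_(p, q))
    (y : A) : Prop :=
  exists (g : 'I_r -> 'I_p) (h : 'I_r -> 'I_q),
    [/\ {homo g : i j / (i < j)%N}, {homo h : i j / (i < j)%N}
      & y = \det (mxsub g h M)].

(* J_{>= d} for a homogeneous ideal J: the elements of J all of whose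
   monomials have degree >= d. *)
Definition truncation (k : fieldType) (n : nat) (J : {mpoly k[n]} -> Prop)
    (d : nat) (u : {mpoly k[n]}) : Prop :=
  J u /\ forall m, m \in msupp u -> (d <= mdeg m)%N.

Definition pair2 (X : Type) (x1 x2 : X) (l : 'I_2) : X :=
  if l == ord0 then x1 else x2.

(* A multi-index (j_{n-1}, ..., j_1) is the function sending the ordinal i to
   j_{i+1}. *)
Definition nondecr n a (j : {ffun 'I_n.-1 -> 'I_a.+1}) : bool :=
  [forall i : 'I_n.-1, forall i' : 'I_n.-1, (i <= i')%N ==> (j i <= j i')%N].

Definition Jset (n a : nat) : finType :=
  {j : {ffun 'I_n.-1 -> 'I_a.+1} | nondecr j}.

(* jval j i = j_i for 0 <= i <= n, with j_0 = 0 and j_n = a. *)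
Definition jval n a (j : Jset n a) (i : nat) : nat :=
  if i is i'.+1 then oapp (fun o => nat_of_ord (sval j o)) a (insub i') else 0%N.

Definition jpos n a (j : Jset n a) : bool := (1 <= jval j 1)%N.

(* The ordinal i : 'I_n stands for the 1-based index i+1. *)
Definition jmon n a (j : Jset n a) : 'X_{1..n} :=
  [multinom (jval j i.+1 - jval j i)%N | i < n].

(* (j_{n-1}, ..., j_{s+1}, j_s - 1, ..., j_1 - 1): the decrement attached to
   the row number s+1. *)
Lemma jdec_subproof n a (j : Jset n a) (s : nat) :
  nondecr [ffun i : 'I_n.-1 =>
             if (i < s)%N then inord (sval j i).-1 else sval j i].
Proof.
case: j => j /= /forallP hj; apply/forallP => i; apply/forallP => i'.
apply/implyP => le_ii'; have := forallP (hj i) i'; rewrite le_ii' /= => jle.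
have h (x : 'I_a.+1) : (inord x.-1 : 'I_a.+1) = x.-1 :> nat.
  by rewrite inordK // ltnS (leq_trans (leq_pred _)) // -ltnS.
rewrite !ffunE; case: ifP => hi; case: ifP => hi' //.
- by rewrite !h; case: (nat_of_ord (j i)) jle => //= x; case: (nat_of_ord (j i')).
- by rewrite h (leq_trans (leq_pred _)).
- by rewrite (leq_ltn_trans le_ii' hi') in hi.
Qed.

Definition jdec n a (j : Jset n a) (s : nat) : Jset n a :=
  exist (fun f => is_true (nondecr f)) _ (jdec_subproof j s).

Section Rees.
Variables (k : fieldType) (n : nat) (a : 'I_2 -> nat).

(* The pairs (l, j) with j in J_{a_l}, and those with j in J'_{a_l}; the
   ordinals 0, 1 : 'I_2 stand for l = 1, 2. *)
Definition Tidx : finType := {l : 'I_2 & Jset n (a l)}.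
Definition Tidx' (lj : Tidx) : bool := jpos (tagged lj).

(* S = T[x_1, ..., x_n] with T = k[T_{l,j}], and R[t_1, t_2]. *)
Local Notation polS := {mpoly {mpoly k[#|Tidx|]}[n]}.
Local Notation polRt := {mpoly {mpoly k[n]}[2]}.

Definition xvar (i : 'I_n) : polS := 'X_i.
Definition Tvar (lj : Tidx) : polS := ('X_(enum_rank lj))%:MP.
Definition R_to_S (u : {mpoly k[n]}) : polS := map_mpoly (@mpolyC #|Tidx| k) u.

Definition bihomog (p q : int) (F : polS) : Prop :=
  forall m, m \in msupp F ->
    (mdeg m)%:Z = p /\ forall m', m' \in msupp F@_m -> (mdeg m')%:Z = q.

Definition xt (lj : Tidx) : polRt := ('X_[jmon (tagged lj)])%:MP * 'X_(tag lj).

Definition ReesM : polRt -> Prop :=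
  @adjoin {mpoly k[n]} polRt (fun y => exists lj, y = xt lj).

Definition phi : polS -> polRt :=
  mmap (mmap (@mpolyC 2 {mpoly k[n]} \o @mpolyC n k) (fun i => xt (enum_val i)))
       (fun i => ('X_i)%:MP).

Definition ReesM_bideg (p q : int) : polRt -> Prop :=
  image_of phi (bihomog p q).

(* Psi is given on all of R[t_1, t_2] by t_l |-> f_l t. *)
Definition Psi (f : 'I_2 -> {mpoly k[n]}) : polRt -> {poly {mpoly k[n]}} :=
  mmap polyC (fun l => f l *: 'X).

Definition chi (f : 'I_2 -> {mpoly k[n]}) (F : polS) : {poly {mpoly k[n]}} :=
  Psi f (phi F).

Definition ker_chi (f : 'I_2 -> {mpoly k[n]}) (F : polS) : Prop := chi f F = 0.

Definition Tidx_key (lj : Tidx) : seqlexi nat :=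
  (tag lj : nat) ::
  rev [seq nat_of_ord (sval (tagged lj) i) | i <- enum 'I_n.-1].

Definition Ccols : seq Tidx :=
  sort (fun lj lj' => (Tidx_key lj <= Tidx_key lj')%O) (enum Tidx').

Definition Tvar_dec (lj : Tidx) (s : nat) : polS :=
  Tvar (Tagged (fun l => Jset n (a l)) (jdec (tagged lj) s)).

Definition Cmx : 'M[polS]_(n, (size Ccols).+1) :=
  \matrix_(s, c) nth 0 (xvar s :: [seq Tvar_dec lj s | lj <- Ccols]) c.

Definition Lideal : polRt -> Prop :=
  ideal_gen ReesM
    (fun y => exists s c, nat_of_ord s = 0%N /\ y = phi (Cmx s c)).

Definition hform (c : Jset n (a ord0) -> {mpoly k[n]})
    (b : Jset n (a ord_max) -> {mpoly k[n]}) : polS :=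
  - (\sum_kk R_to_S (c kk) * Tvar (Tagged (fun l => Jset n (a l)) kk))
  + \sum_kk R_to_S (b kk) * Tvar (Tagged (fun l => Jset n (a l)) kk).

(* U and V(s1, s2) are isomorphic as bigraded modules, for U, V homogeneous
   ideals of R(M), where V(s1, s2)_(p, q) = V_(p + s1, q + s2). *)
Definition bigraded_iso (U V : polRt -> Prop) (s1 s2 : int) : Prop :=
  exists theta : polRt -> polRt,
    [/\ forall r u v, ReesM r -> U u -> U v ->
          theta (r * u + v) = r * theta u + theta v,
        forall u, U u -> V (theta u),
        forall u v, U u -> U v -> theta u = theta v -> u = v,
        forall v, V v -> exists2 u, U u & theta u = v
      & forall p q u, U u -> ReesM_bideg p q u ->
          ReesM_bideg (p + s1) (q + s2) (theta u)].

End Rees.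

Arguments phi {k n} a F : rename.
Arguments chi {k n} a f F.
Arguments ker_chi {k n} a f F.
Arguments hform {k n} a c b.
Arguments bigraded_iso {k n} a U V s1 s2.

Definition ReesI (k : fieldType) (n : nat) (I : {mpoly k[n]} -> Prop) :
    {poly {mpoly k[n]}} -> Prop :=
  @adjoin {mpoly k[n]} {poly {mpoly k[n]}}
    (fun y => exists2 u, I u & y = u *: 'X).

(* Main.v *)
(* Give R[t_1, t_2] the grading with deg x_i = 1 and deg t_l = -a_l. A monomial
   lies in R(M) iff its degree is >= 0, so R(M) is the nonnegative part. Since
   f_1, f_2 is a regular sequence, the kernel of t_l |-> f_l t on R[t_1, t_2]
   is generated by the single form g = f_1 t_2 - f_2 t_1, which is homogeneous
   of degree d_1 + d_2 - d; as R[t_1, t_2] is a domain, A R(M) is therefore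
   g times the part of R[t_1, t_2] in degrees >= d - d_1 - d_2.

   L = x_1 R[t_1, t_2] \cap R(M), and L^(e) = x_1^e R[t_1, t_2] \cap R(M)
   because powers of x_2, which are not in L, clear any negative degree; on the
   other hand phi(h_m) = m g. Both sides of the main equality are then
   x_1^delta g times the same graded piece.

   For d >= d_1 + d_2 it remains to see that ker phi = I_2(C): two monomials
   of S with the same image under phi differ by successive exchanges of an x_r
   in one variable with an x_s in another, and each exchange is a minor of C. *)

Require Import Defs.
From mathcomp Require Import all_boot all_order all_algebra.
From mathcomp Require Import zify ring fraction.
From Stdlib Require Import ClassicalEpsilon.

Set Implicit Arguments.
Unset Strict Implicit.
Unset Printing Implicit Defensive.

Import Order.TTheory GRing.Theory Num.Theory.
Local Open Scope ring_scope.

(** * Ideals and iterated polynomial rings *)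

Section IdealGen.
Variables (A : comNzRingType) (B : A -> Prop).
Implicit Types (G U V : A -> Prop).

Lemma ideal_gen0 G : ideal_gen B G 0.
Proof. by exists [::] => //; rewrite big_nil. Qed.

Lemma ideal_genD G y z :
  ideal_gen B G y -> ideal_gen B G z -> ideal_gen B G (y + z).
Proof.
move=> [s hs ->] [s' hs' ->]; exists (s ++ s'); last by rewrite big_cat.
by move=> p; rewrite mem_cat => /orP[/hs|/hs'].
Qed.

Lemma ideal_gen_mem G r u : B r -> G u -> ideal_gen B G (r * u).
Proof.
move=> Br Gu; exists [:: (r, u)]; last by rewrite big_seq1.
by move=> p; rewrite inE => /eqP ->.
Qed.

(** Serves as the induction principle for generated ideals: an element is a finite sum of products,
    so closure under sums and the single products suffice. *)
Lemma ideal_gen_min G V :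
    V 0 -> (forall y z, V y -> V z -> V (y + z)) ->
    (forall r u, B r -> G u -> V (r * u)) ->
  forall y, ideal_gen B G y -> V y.
Proof.
move=> V0 VD VG y [s hs ->]; rewrite big_seq.
by elim/big_ind: _ => // p /hs[Bp Gp]; apply: VG.
Qed.

Lemma ideal_genM G r y : (forall u v, B u -> B v -> B (u * v)) ->
  B r -> ideal_gen B G y -> ideal_gen B G (r * y).
Proof.
move=> BM Br [s hs ->]; exists [seq (r * p.1, p.2) | p <- s].
  by move=> _ /mapP[p /hs[Bp Gp] ->] /=; split=> //; apply: BM.
by rewrite big_map mulr_sumr; apply: eq_bigr => p _; rewrite mulrA.
Qed.

End IdealGen.

Section WholeIdeal.
Variables (A : comNzRingType) (G : A -> Prop).

Lemma whole_ideal_genM r y :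
  ideal_gen (@whole A) G y -> ideal_gen (@whole A) G (r * y).
Proof. exact: ideal_genM. Qed.

Lemma whole_ideal_gen_mem u : G u -> ideal_gen (@whole A) G u.
Proof. by move=> Gu; rewrite -[u]mul1r; apply: ideal_gen_mem. Qed.

End WholeIdeal.

Lemma principal_idealP (A : comNzRingType) (r y : A) :
  ideal_gen (@whole A) (fun z => z \in [:: r]) y <-> exists u, y = u * r.
Proof.
split; last by case=> u ->; apply: ideal_gen_mem; rewrite // inE.
move: y; apply: ideal_gen_min => [|_ _ [u ->] [v ->]|u z _].
- by exists 0; rewrite mul0r.
- by exists (u + v); rewrite mulrDl.
- by rewrite inE => /eqP ->; exists u.
Qed.

Lemma idomain_mulf_eq0 (D : idomainType) (y z : D) :
  y * z = 0 -> y = 0 \/ z = 0.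
Proof. by move/eqP; rewrite mulf_eq0 => /orP[]/eqP; [left | right]. Qed.

(** * Terms and supports in an iterated polynomial ring k[X][Y] *)

Section Nested.
Variables (k : fieldType) (p q : nat).
Local Notation P := {mpoly {mpoly k[p]}[q]}.
Implicit Types (y z : P) (c : k).

(* Both S and R[t_1, t_2] are of the form k[X][Y]; [mon u v] is X^u Y^v, and
   the coefficient of y at X^u Y^v is [y@_v@_u]. *)
Definition mon (u : 'X_{1..p}) (v : 'X_{1..q}) : P := ('X_[u])%:MP * 'X_[v].
Definition scal c : P := (c%:MP)%:MP.

Lemma monM u v u' v' : mon u v * mon u' v' = mon (u + u')%MM (v + v')%MM.
Proof. by rewrite /mon !mpolyXD mpolyCM; ring. Qed.

Lemma mon0 : mon 0%MM 0%MM = 1.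
Proof. by rewrite /mon !mpolyX0 mpolyC1 mul1r. Qed.

Lemma coef_scal_mon c u v u' v' :
  (scal c * mon u v)@_v'@_u' = c *+ ((v == v') && (u == u')).
Proof.
rewrite /scal /mon mulrA -mpolyCM !mcoeffCM mcoeffX.
case: (v == v'); rewrite ?mulr1 ?mulr0 ?mcoeff0 ?andbF //=.
by rewrite mcoeffCM mcoeffX mulr_natr.
Qed.

Lemma coef_mon u v u' v' :
  (mon u v)@_v'@_u' = ((v == v') && (u == u'))%:R.
Proof. by rewrite -[mon u v]mul1r -(coef_scal_mon 1) /scal !mpolyC1. Qed.

Lemma mon_inj u v u' v' : mon u v = mon u' v' -> u = u' /\ v = v'.
Proof.
move/(congr1 (fun y => y@_v'@_u')); rewrite !coef_mon !eqxx.
case: eqP => [->|_] /=; last by move/esym/eqP; rewrite oner_eq0.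
by case: eqP => [->|_] //; move/esym/eqP; rewrite oner_eq0.
Qed.

Lemma mon_neq0 u v : mon u v <> 0.
Proof.
move=> /(congr1 (fun y => y@_v@_u)); rewrite coef_mon !eqxx !mcoeff0.
by apply/eqP/oner_neq0.
Qed.

Lemma nested_expand y :
  y = \sum_(v <- msupp y) \sum_(u <- msupp y@_v) scal y@_v@_u * mon u v.
Proof.
rewrite {1}(mpolyE y); apply: eq_bigr => v _.
rewrite {1}(mpolyE y@_v) -mul_mpolyC raddf_sum mulr_suml; apply: eq_bigr => u _.
by rewrite /= -mul_mpolyC mpolyCM -mulrA.
Qed.

(** Induction over the terms of a fixed y: only terms that occur in y have to satisfy K, so a
    support condition on y is available for each of them. *)
Lemma nested_ind (K : P -> Prop) : K 0 ->
    (forall y z, K y -> K z -> K (y + z)) ->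
  forall y, (forall u v, y@_v@_u != 0 -> K (scal y@_v@_u * mon u v)) -> K y.
Proof.
move=> K0 KD y Ky; rewrite [y]nested_expand.
elim/big_ind: _ => // v _; rewrite big_seq; elim/big_ind: _ => // u.
by rewrite mcoeff_msupp; apply: Ky.
Qed.

Lemma nested_mulf_eq0 y z : y * z = 0 -> y = 0 \/ z = 0.
Proof.
(* The product of P as a commutative ring and as a domain agree only after
   unfolding two towers of instances, which the kernel does much faster than
   unification. *)
exact_no_check (@idomain_mulf_eq0 P y z).
Qed.

Lemma nested_mulfI r y z : r <> 0 -> r * y = r * z -> y = z.
Proof.
move=> r0 eq_r; have /nested_mulf_eq0[//|/eqP] : r * (y - z) = 0.
  by rewrite mulrBr eq_r subrr.
by rewrite subr_eq0 => /eqP.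
Qed.

(** Membership in R(M), divisibility by x_1, homogeneity and lower bounds on the weight are all
    expressed in this form. *)
Definition supp (Q : 'X_{1..p} -> 'X_{1..q} -> Prop) y : Prop :=
  forall u v, y@_v@_u != 0 -> Q u v.

Implicit Types Q : 'X_{1..p} -> 'X_{1..q} -> Prop.

Lemma supp0 Q : supp Q 0.
Proof. by move=> u v; rewrite !mcoeff0 eqxx. Qed.

Lemma suppD Q y z : supp Q y -> supp Q z -> supp Q (y + z).
Proof.
move=> hy hz u v; rewrite !mcoeffD.
by case: (eqVneq y@_v@_u 0) => [->|/hy //]; rewrite add0r => /hz.
Qed.

Lemma suppN Q y : supp Q y -> supp Q (- y).
Proof. by move=> hy u v; rewrite !mcoeffN oppr_eq0 => /hy. Qed.

Lemma suppB Q y z : supp Q y -> supp Q z -> supp Q (y - z).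
Proof. by move=> hy hz; apply: (suppD hy); apply: suppN. Qed.

Lemma supp_term Q c u v : (c != 0 -> Q u v) -> supp Q (scal c * mon u v).
Proof.
move=> h u' v'; rewrite coef_scal_mon; case: (v =P v') => [<-|_]; last by rewrite eqxx.
by case: (u =P u') => [<-|_]; [apply: h | rewrite eqxx].
Qed.

Lemma supp_mon Q u v : Q u v -> supp Q (mon u v).
Proof. by move=> h; rewrite -[mon u v]mul1r; apply: (@supp_term Q 1). Qed.

Lemma supp_sub Q Q' y : (forall u v, Q u v -> Q' u v) -> supp Q y -> supp Q' y.
Proof. by move=> h hy u v /hy/h. Qed.

Lemma suppM Q Q' Q'' y z :
    (forall u v u' v', Q u v -> Q' u' v' -> Q'' (u + u')%MM (v + v')%MM) ->
  supp Q y -> supp Q' z -> supp Q'' (y * z).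
Proof.
move=> h hy hz; apply: (@nested_ind (fun y => supp Q'' (y * z))).
- by rewrite mul0r; apply: supp0.
- by move=> y1 y2 h1 h2; rewrite mulrDl; apply: suppD.
move=> u v /hy Quv; apply: (@nested_ind (fun z => supp Q'' (_ * z))).
- by rewrite mulr0; apply: supp0.
- by move=> z1 z2 h1 h2; rewrite mulrDr; apply: suppD.
move=> u' v' /hz Quv'; rewrite mulrACA monM -mpolyCM -mpolyCM.
by apply: supp_term => _; apply: h.
Qed.

Lemma supp_split (Q : 'X_{1..p} -> 'X_{1..q} -> bool) y :
  exists y1 y2, [/\ y = y1 + y2, supp Q y1 & supp (fun u v => ~~ Q u v) y2].
Proof.
apply: (@nested_ind (fun y => exists y1 y2, [/\ y = y1 + y2, supp Q y1 &
  supp (fun u v => ~~ Q u v) y2])).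
- by exists 0, 0; split; rewrite ?addr0 //; apply: supp0.
- move=> _ _ [y1 [y2 [-> h1 h2]]] [z1 [z2 [-> h3 h4]]].
  by exists (y1 + z1), (y2 + z2); split; [ring|exact: suppD|exact: suppD].
move=> u v _; case: (boolP (Q u v)) => h.
  exists (scal y@_v@_u * mon u v), 0; rewrite addr0.
  by split=> //; [apply: supp_term | apply: supp0].
exists 0, (scal y@_v@_u * mon u v); rewrite add0r.
by split=> //; [apply: supp0 | apply: supp_term].
Qed.

Lemma supp_disjoint Q Q' y : (forall u v, Q u v -> Q' u v -> False) ->
  supp Q y -> supp Q' y -> y = 0.
Proof.
move=> h hy hy'; apply/mpolyP => v; apply/mpolyP => u; rewrite !mcoeff0.
by case: (eqVneq y@_v@_u 0) => // nz; case: (h _ _ (hy _ _ nz) (hy' _ _ nz)).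
Qed.

(* The part of y outside the claimed support, multiplied by r, is supported
   both inside and outside Q. *)
Lemma supp_homog_divr (D : nmodType) (wt : 'X_{1..p} -> 'X_{1..q} -> D)
    (w : D) (Q : pred D) r y :
    (forall u v u' v', wt (u + u')%MM (v + v')%MM = wt u v + wt u' v') ->
    r <> 0 -> supp (fun u v => wt u v = w) r ->
    supp (fun u v => Q (wt u v)) (r * y) ->
  supp (fun u v => Q (w + wt u v)) y.
Proof.
move=> wtD r0 hr hry.
have [y1 [y2 [def_y h1 h2]]] := supp_split (fun u v => Q (w + wt u v)) y.
suff /nested_mulf_eq0[//|y20] : r * y2 = 0 by rewrite def_y y20 addr0.
apply: (@supp_disjoint (fun u v => Q (wt u v)) (fun u v => ~~ Q (wt u v))) => [u v ->//||].
  have -> : r * y2 = r * y - r * y1 by rewrite def_y; ring.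
  by apply: suppB => //; apply: suppM hr h1 => u v u' v' /= <-; rewrite wtD.
by apply: suppM hr h2 => u v u' v' /= <-; rewrite wtD.
Qed.

Lemma mon_dvd (u0 : 'X_{1..p}) y : supp (fun u _ => (u0 <= u)%MM) y ->
  exists z, y = mon u0 0%MM * z.
Proof.
move=> hy; apply: (@nested_ind (fun y => exists z, y = mon u0 0%MM * z)).
- by exists 0; rewrite mulr0.
- by move=> _ _ [z1 ->] [z2 ->]; exists (z1 + z2); rewrite mulrDr.
move=> u v /hy h; exists (scal y@_v@_u * mon (u - u0)%MM v).
by rewrite [RHS]mulrCA monM add0m addmC submK.
Qed.

End Nested.

Arguments mon {k p q} u v.
Arguments scal {k p q} c.

(** * The kernel of Psi *)

Lemma ord2P (l : 'I_2) : l = ord0 \/ l = ord_max.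
Proof. by case: l => [[|[|//]] h]; [left | right]; apply: val_inj. Qed.

Lemma big_ord2 (T : Type) (idx : T) (op : Monoid.law idx) (F : 'I_2 -> T) :
  \big[op/idx]_(i < 2) F i = op (F ord0) (F ord_max).
Proof.
rewrite !big_ord_recl big_ord0 Monoid.mulm1; congr (op _ (F _)).
exact: val_inj.
Qed.

Section KerPsi.
Variables (k : fieldType) (n : nat) (f : 'I_2 -> {mpoly k[n]}).
Local Notation R := {mpoly k[n]}.
Local Notation Rt := {mpoly R[2]}.
Implicit Types (y z w : Rt).

(** The Koszul relation between f_1 and f_2, read as a linear form in t_1, t_2; [ord0] and [ord_max]
    stand for the indices 1 and 2. *)
Definition koszul : Rt := (f ord0)%:MP * 'X_ord_max - (f ord_max)%:MP * 'X_ord0.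

Lemma PsiM y z : Psi f (y * z) = Psi f y * Psi f z.
Proof. exact: rmorphM. Qed.

Lemma PsiD y z : Psi f (y + z) = Psi f y + Psi f z.
Proof. exact: rmorphD. Qed.

Lemma PsiB y z : Psi f (y - z) = Psi f y - Psi f z.
Proof. exact: rmorphB. Qed.

Lemma Psi0 : Psi f 0 = 0.
Proof. exact: rmorph0. Qed.

Lemma PsiC u : Psi f u%:MP = u%:P.
Proof. exact: mmapC. Qed.

Lemma PsiX l : Psi f 'X_l = f l *: 'X.
Proof. by rewrite /Psi mmapX mmap1U. Qed.

Lemma Psi_koszul : Psi f koszul = 0.
Proof. by rewrite PsiB !PsiM !PsiC !PsiX -!mul_polyC; ring. Qed.

Lemma coef_Psi y e : (Psi f y)`_e =
  \sum_(v <- msupp y | mdeg v == e)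
     y@_v * (f ord0 ^+ v ord0 * f ord_max ^+ v ord_max).
Proof.
rewrite /Psi /mmap coef_sum [RHS]big_mkcond; apply: eq_bigr => v _.
rewrite coefCM /mmap1 big_ord2 /= !exprZn -scalerAl -scalerAr scalerA -exprD.
rewrite coefZ coefXn mdegE big_ord2 /= eq_sym.
by case: eqP; rewrite ?mulr1 ?mulr0.
Qed.

Hypothesis f0_neq0 : f ord0 != 0.
Hypothesis f1_reg : forall g,
  (exists u, f ord_max * g = u * f ord0) -> exists u, g = u * f ord0.

Lemma f1_reg_exp e g :
  (exists u, f ord_max ^+ e * g = u * f ord0) -> exists u, g = u * f ord0.
Proof.
elim: e g => [|e IHe] g; first by rewrite mul1r.
by rewrite exprSr -mulrA => /IHe/f1_reg.
Qed.

(* Modulo f_1, the coefficient of t_1^0 t_2^e in an element of the kernel is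
   killed by f_2^e. *)
Lemma Psi_ker_coef y (v : 'X_{1..2}) : Psi f y = 0 -> v ord0 = 0%N ->
  exists u, y@_v = u * f ord0.
Proof.
move=> hy v0; have [vy|/memN_msupp_eq0->] := boolP (v \in msupp y); last first.
  by exists 0; rewrite mul0r.
apply: (@f1_reg_exp (v ord_max)).
have /(congr1 (fun F : {poly R} => F`_(mdeg v))) := hy; rewrite coef0 coef_Psi.
rewrite (big_rem v vy) /= eqxx v0 mul1r mulrC => /eqP.
rewrite addr_eq0 => /eqP ->.
suff [u ->] : exists u, \sum_(i <- rem v (msupp y) | mdeg i == mdeg v)
    y@_i * (f ord0 ^+ i ord0 * f ord_max ^+ i ord_max) = u * f ord0.
  by exists (- u); rewrite mulNr.
rewrite big_seq_cond; elim/big_ind: _ => [|_ _ [u ->] [u' ->]|i].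
- by exists 0; rewrite mul0r.
- by exists (u + u'); rewrite mulrDl.
case/andP; rewrite mem_rem_uniq ?msupp_uniq // inE => /andP[iv _] /eqP di.
case i0: (i ord0) => [|e]; last first.
  by exists (y@_i * (f ord0 ^+ e * f ord_max ^+ i ord_max)); rewrite exprS; ring.
(* An exponent of the same degree without t_1 is v itself, which [rem] has removed; all other terms
   contain a factor f_1. *)
case/negP: iv; apply/eqP/mnmP => l.
move: di; rewrite !mdegE !big_ord2 /= i0 v0 /= !add0n => h.
by case: (ord2P l) => ->; rewrite ?i0 ?v0 ?h.
Qed.

Lemma mpolyX_divU (m : 'X_{1..2}) (i : 'I_2) : (0 < m i)%N ->
  'X_[m] = 'X_i * 'X_[m - U_(i)] :> Rt.
Proof. by move=> h; rewrite -mpolyXD addmC submK // lep1mP -lt0n. Qed.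

(** Induction on a bound for the degree in t. Modulo [koszul] an element of the kernel is a multiple
    of t_1, and t_1 can be cancelled because its image f_1 t is nonzero in a domain. *)
Lemma Psi_ker N y : (forall v, y@_v != 0 -> (mdeg v < N)%N) ->
  Psi f y = 0 -> exists w, y = koszul * w.
Proof.
elim: N y => [|N IHN] y ltN hy.
  exists 0; rewrite mulr0; apply/mpolyP => v; rewrite mcoeff0.
  by case: (eqVneq y@_v 0) => // /ltN.
suff [w [z [def_y ltz]]] : exists w z, y = koszul * w + 'X_ord0 * z /\
    forall v, z@_v != 0 -> (mdeg v < N)%N.
  have [|w' def_z] := IHN z ltz; last first.
    by exists (w + 'X_ord0 * w'); rewrite def_y def_z; ring.
  have := hy; rewrite def_y PsiD !PsiM Psi_koszul mul0r add0r PsiX -mul_polyC => /eqP.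
  by rewrite !mulf_eq0 polyC_eq0 polyX_eq0 (negPf f0_neq0) => /eqP.
rewrite [y]mpolyE big_seq; elim/big_ind: _ => [|_ _ [w [z [-> hz]]] [w' [z' [-> hz']]]|v].
- by exists 0, 0; split=> [|v]; rewrite ?mulr0 ?addr0 // mcoeff0 eqxx.
- exists (w + w'), (z + z'); split=> [|v]; first by ring.
  rewrite mcoeffD; case: (eqVneq z@_v 0) => [->|/hz //].
  by rewrite add0r => /hz'.
rewrite mcoeff_msupp => yv; have dv := ltN _ yv.
have term_lt (u : R) (v' : 'X_{1..2}) : (mdeg v' < N)%N ->
    forall v, (u%:MP * 'X_[v'])@_v != 0 -> (mdeg v < N)%N.
  move=> h v0; rewrite mcoeffCM mcoeffX; case: (v' =P v0) => [<- //|_].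
  by rewrite mulr0 eqxx.
have degB (i : 'I_2) : (0 < v i)%N -> (mdeg (v - U_(i))%MM < N)%N.
  move=> vi; have := dv; rewrite -{1}[v](@submK _ U_(i)%MM) ?lep1mP -?lt0n //.
  by rewrite mdegD mdeg1 addn1.
case: (posnP (v ord0)) => v0; last first.
  exists 0, ((y@_v)%:MP * 'X_[v - U_(ord0)]); split; last exact/term_lt/degB.
  by rewrite mulr0 add0r -mul_mpolyC (mpolyX_divU v0) mulrCA.
have [u def_u] := Psi_ker_coef hy v0.
(* The constant term cannot occur: the coefficient of t^0 in [Psi f y] is that of y itself. *)
case: (posnP (v ord_max)) => v1.
  have v00 : v = 0%MM.
    by apply/mnmP => l; case: (ord2P l) => ->; rewrite ?v0 ?v1 mnm0E.
  case/negP: (yv); apply/eqP.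
  have := congr1 (fun F : {poly R} => F`_0) hy; rewrite /= coef_Psi coef0.
  rewrite (eq_bigl (fun i => i == v)) => [|i]; last by rewrite mdeg_eq0 v00.
  rewrite -big_filter filter_pred1_uniq ?mcoeff_msupp ?msupp_uniq //.
  by rewrite big_seq1 v0 v1 !expr0 !mulr1.
(* With coefficient u f_1, the identity f_1 t_2 = g + f_2 t_1 splits the term into a multiple of g
   and a multiple of t_1. *)
exists (u%:MP * 'X_[v - U_(ord_max)]), ((u * f ord_max)%:MP * 'X_[v - U_(ord_max)]).
split; last exact/term_lt/degB.
rewrite -mul_mpolyC (mpolyX_divU v1) def_u /koszul !mpolyCM; ring.
Qed.

End KerPsi.

(** * The monomials of degree a *)

Section MultiIndices.
Variables (n a : nat) (n_gt0 : (0 < n)%N).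
Implicit Types (j : Jset n a) (u : 'X_{1..n}).
Local Open Scope nat_scope.
Let i0 : 'I_n := Ordinal n_gt0.

Lemma jval_ord j (i : 'I_n.-1) : jval j i.+1 = sval j i.
Proof. by rewrite /jval /= valK. Qed.

Lemma jval_n j : jval j n = a.
Proof. by case: n n_gt0 j => // n' _ j; rewrite /= insubF //= ltnn. Qed.

Lemma jval_leS j i : i < n -> jval j i <= jval j i.+1.
Proof.
case: i => // i lt_i; have hi : i < n.-1 by lia.
rewrite (jval_ord j (Ordinal hi)) [jval j i.+2]/=.
case: insubP => [o _ def_o|_] /=; last by rewrite -ltnS ltn_ord.
have /forallP/(_ (Ordinal hi))/forallP/(_ o)/implyP := svalP j.
by apply; rewrite /= def_o.
Qed.

(** The exponents of [jmon j] are consecutive differences, so they telescope; this inverts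
    [jmon]. *)
Lemma jval_sum j i : i <= n -> jval j i = \sum_(x < n | x < i) jmon j x.
Proof.
elim: i => [|i IHi] lt_i; first by rewrite big_pred0.
rewrite (bigD1 (Ordinal lt_i)) //= mnmE /= (eq_bigl (fun x : 'I_n => x < i)).
  by rewrite -(IHi (ltnW lt_i)) subnK ?jval_leS.
by move=> x; rewrite -val_eqE /= ltnS ltn_neqAle andbC.
Qed.

Lemma mdeg_jmon j : mdeg (jmon j) = a.
Proof.
rewrite -[RHS](jval_n j) (jval_sum j (leqnn n)) mdegE.
by apply: eq_bigl => x; rewrite ltn_ord.
Qed.

Lemma jmon_inj : injective (@jmon n a).
Proof.
move=> j j' eq_jj'; apply: val_inj; apply/ffunP => i; apply: ord_inj.
have lt_i : i.+1 <= n by have := ltn_ord i; lia.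
rewrite -!jval_ord !jval_sum //; apply: eq_bigr => x _.
by rewrite eq_jj'.
Qed.

(** The multi-index is the sequence F of partial sums of the exponents; it stays below a, so [inord]
    does not alter it. *)
Lemma jmon_surj u : mdeg u = a -> exists j, jmon j = u.
Proof.
move=> du; pose F i := \sum_(x < n | x < i) u x.
have leF i i' : i <= i' -> F i <= F i'.
  move=> le_ii'; rewrite /F [leqRHS](bigID (fun x : 'I_n => x < i)) /=.
  apply: leq_trans (leq_addr _ _); rewrite (eq_bigl (fun x : 'I_n => (x < i') && (x < i))) //.
  by move=> x /=; case: ltnP => // h; rewrite ?andbF // (leq_trans h).
have Fn : F n = a by rewrite -du mdegE; apply: eq_bigl => x; rewrite ltn_ord.
have F_le i : i <= n -> F i <= a by rewrite -Fn; apply: leF.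
have lt_i (i : 'I_n.-1) : i.+1 <= n by have := ltn_ord i; lia.
pose jf := [ffun i : 'I_n.-1 => inord (F i.+1) : 'I_a.+1].
have jfE i : jf i = F i.+1 :> nat by rewrite ffunE inordK // ltnS F_le.
have hj : nondecr jf.
  by apply/forallP => i; apply/forallP => i'; apply/implyP => h; rewrite !jfE leF.
pose j : Jset n a := exist (fun f => is_true (nondecr f)) jf hj.
have jE i : i <= n -> jval j i = F i.
  case: i => [|i] hi; first by rewrite /F big_pred0.
  rewrite /=; case: insubP => [o _ <- /=|]; first by rewrite jfE.
  (* The only index outside ['I_n.-1] is n, where [jval] takes its default value a. *)
  by rewrite -leqNgt => h; have <- : n = i.+1 by lia.
exists j; apply/mnmP => x; rewrite mnmE !jE ?ltn_ord // 1?ltnW //.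
rewrite {1}/F (bigD1 x) //= (eq_bigl (fun y : 'I_n => y < x)) ?addnK //.
by move=> y; rewrite -val_eqE /= ltnS ltn_neqAle andbC.
Qed.

Lemma jposE j : jpos j = (0 < jmon j i0).
Proof. by rewrite /jpos mnmE subn0. Qed.

Lemma jval_dec j (s : 'I_n) i : jval (jdec j s) i = jval j i - (0 < i <= s).
Proof.
case: i => // i; rewrite /jval; case: insubP => [o _ <-|] /=.
  rewrite ffunE; case: ifP => _; last by rewrite subn0.
  by rewrite inordK ?subn1 // ltnS (leq_trans (leq_pred _)) // -ltnS.
rewrite -leqNgt => h; have := ltn_ord s; case: (leqP i.+1 s) => /= ?; last by rewrite subn0.
by lia.
Qed.

(** Lowering an initial run of the j_i by one changes only the differences at its two ends: x_1 is
    replaced by the variable of row s. The equation is additive because subtraction of exponents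
    truncates. *)
Lemma jmon_dec j (s : 'I_n) : jpos j ->
  (jmon (jdec j s) + U_(i0) = jmon j + U_(s))%MM.
Proof.
move=> j_pos; apply/mnmP => x; rewrite !mnmDE !mnm1E !mnmE !jval_dec -!val_eqE.
(* As j_1 >= 1 and the j_i increase, no predecessor of 0 is ever taken. *)
have jx : 0 < x -> 0 < jval j x.
  case: x => x /= lt_x; elim: x lt_x => // x IHx lt_x _.
  case: x IHx lt_x => [|x] IHx lt_x //.
  exact: leq_trans (IHx (ltnW lt_x) _) (jval_leS _ (ltnW lt_x)).
have := jval_leS j (ltn_ord x); case: (posnP x) => [x0|x_gt0].
  move: j_pos; rewrite /jpos x0; case: s => [s h]; rewrite [val _]/= [val _]/= [val _]/=.
  by case: s h => [|s] h; rewrite [(0 < _)%N]/= /=; lia.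
have := jx x_gt0; move: x_gt0; case: s => s h; move: (jval j x.+1) (jval j x) => J J' /=.
by lia.
Qed.

End MultiIndices.

(** * The Rees algebra of M *)

Section Multinomials.
Variable n : nat.
Implicit Types u v w : 'X_{1..n}.

Lemma mdeg_lt_exists u v : (mdeg u < mdeg v)%N -> exists i, (u i < v i)%N.
Proof.
move=> lt_uv; apply/existsP; apply: contraLR lt_uv.
rewrite negb_exists -leqNgt !mdegE => /forallP h.
by apply: leq_sum => i _; rewrite leqNgt h.
Qed.

Lemma mnm_between u w d : (u <= w)%MM -> (mdeg u <= d <= mdeg w)%N ->
  exists v, [/\ (u <= v)%MM, (v <= w)%MM & mdeg v = d].
Proof.
move=> le_uw /andP[le_ud]; rewrite -(subnKC le_ud); elim: (d - mdeg u)%N => [|e IHe].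
  by exists u; rewrite addn0 lepm_refl.
move=> lt_e; have [|v [le_uv le_vw dv]] := IHe; first by lia.
have [|i lt_i] := @mdeg_lt_exists v w; first by lia.
exists (v + U_(i))%MM; split; last by rewrite mdegD mdeg1; lia.
  exact: lepm_trans le_uv (lem_addr _ _).
apply/mnm_lepP => x; rewrite mnmDE mnm1E; have /mnm_lepP/(_ x) := le_vw.
by case: eqP => [<-|_]; rewrite ?addn1 ?addn0.
Qed.

Lemma lem1m u : (0 <= u)%MM.
Proof. by apply/mnm_lepP => i; rewrite mnm0E. Qed.

Lemma mnm_gt0_exists u : (0 < mdeg u)%N -> exists i, (0 < u i)%N.
Proof.
move=> h; have [|i] := @mdeg_lt_exists 0%MM u; first by rewrite mdeg0.
by rewrite mnm0E; exists i.
Qed.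

Lemma mnm_subK u i : (0 < u i)%N -> u = (u - U_(i) + U_(i))%MM.
Proof. by move=> h; rewrite submK // lep1mP -lt0n. Qed.

End Multinomials.

Section MonExp.
Variables (k : fieldType) (p q : nat).

Lemma mon_sum (I : Type) (s : seq I) (A : I -> 'X_{1..p}) (B : I -> 'X_{1..q}) :
  \prod_(i <- s) mon (A i) (B i) =
  mon (\sum_(i <- s) A i)%MM (\sum_(i <- s) B i)%MM :> {mpoly {mpoly k[p]}[q]}.
Proof.
elim: s => [|i s IHs]; first by rewrite !big_nil mon0.
by rewrite !big_cons IHs monM.
Qed.

Lemma mon_exp u v e :
  mon u v ^+ e = mon (u *+ e)%MM (v *+ e)%MM :> {mpoly {mpoly k[p]}[q]}.
Proof.
elim: e => [|e IHe]; first by rewrite expr0 !mulm0n mon0.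
by rewrite exprS IHe monM !mulmS.
Qed.

Lemma mmap1_mon r (A : 'I_r -> 'X_{1..p}) (B : 'I_r -> 'X_{1..q}) m :
  mmap1 (fun i => mon (A i) (B i) : {mpoly {mpoly k[p]}[q]}) m =
  mon (\sum_i A i *+ m i)%MM (\sum_i B i *+ m i)%MM.
Proof. by rewrite -mon_sum; apply: eq_bigr => i _; rewrite mon_exp. Qed.

End MonExp.

(** * The monomial map phi and its image R(M) *)

Section Rees.
Variables (k : fieldType) (n : nat) (a : 'I_2 -> nat).
Local Notation N := #|Tidx n a|.
Local Notation S := {mpoly {mpoly k[N]}[n]}.
Local Notation Rt := {mpoly {mpoly k[n]}[2]}.
Implicit Types (F G : S) (y z : Rt) (tau : 'X_{1..N}) (u xi : 'X_{1..n}) (v : 'X_{1..2}).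

Definition jmonT (i : 'I_N) : 'X_{1..n} := jmon (tagged (enum_val i)).
Definition tagT (i : 'I_N) : 'I_2 := tag (enum_val i).

Definition xdeg tau xi : 'X_{1..n} := (xi + \sum_i jmonT i *+ tau i)%MM.
Definition tdeg tau : 'X_{1..2} := (\sum_i U_(tagT i) *+ tau i)%MM.

Lemma xdegD tau tau' xi xi' :
  xdeg (tau + tau')%MM (xi + xi')%MM = (xdeg tau xi + xdeg tau' xi')%MM.
Proof.
apply/mnmP => x; rewrite !mnmDE !mnm_sumE addnACA -big_split /=.
by congr (_ + _)%N; apply: eq_bigr => i _; rewrite !mulmnE mnmDE mulnDr.
Qed.

Lemma tdegD tau tau' : tdeg (tau + tau')%MM = (tdeg tau + tdeg tau')%MM.
Proof.
apply/mnmP => x; rewrite !mnmDE !mnm_sumE -big_split /=.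
by apply: eq_bigr => i _; rewrite !mulmnE mnmDE mulnDr.
Qed.

Lemma xdegx xi : xdeg 0%MM xi = xi.
Proof.
apply/mnmP => x; rewrite mnmDE mnm_sumE big1 ?addn0 // => i _.
by rewrite mulmnE mnm0E muln0.
Qed.

Lemma tdeg0 : tdeg 0%MM = 0%MM.
Proof.
apply/mnmP => x; rewrite mnm_sumE mnm0E big1 // => i _.
by rewrite mulmnE mnm0E muln0.
Qed.

Lemma xdegT i : xdeg U_(i)%MM 0%MM = jmonT i.
Proof.
rewrite /xdeg add0m (bigD1 i) //= big1 => [|i' ne].
  by rewrite mnm1E eqxx mulm1n addm0.
by rewrite mnm1E eq_sym (negPf ne) mulm0n.
Qed.

Lemma tdegT i : tdeg U_(i)%MM = U_(tagT i)%MM.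
Proof.
rewrite /tdeg (bigD1 i) //= big1 => [|i' ne].
  by rewrite mnm1E eqxx mulm1n addm0.
by rewrite mnm1E eq_sym (negPf ne) mulm0n.
Qed.

Lemma mdeg_tdeg tau : mdeg (tdeg tau) = mdeg tau.
Proof.
rewrite mdeg_sum mdegE; apply: eq_bigr => i _.
by rewrite mdegMn mdeg1 mul1n.
Qed.

Lemma phiD F G : phi a (F + G) = phi a F + phi a G.
Proof. exact: rmorphD. Qed.

Lemma phiB F G : phi a (F - G) = phi a F - phi a G.
Proof. exact: rmorphB. Qed.

Lemma phiN F : phi a (- F) = - phi a F.
Proof. exact: rmorphN. Qed.

Lemma phiM F G : phi a (F * G) = phi a F * phi a G.
Proof. exact: rmorphM. Qed.

Lemma phi0 : phi a (0 : S) = 0.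
Proof. exact: rmorph0. Qed.

Lemma phi_sum (I : Type) (s : seq I) (P : pred I) (H : I -> S) :
  phi a (\sum_(i <- s | P i) H i) = \sum_(i <- s | P i) phi a (H i).
Proof. exact: rmorph_sum. Qed.

Lemma phi_scal (c : k) : phi a (scal c : S) = scal c.
Proof. by rewrite /phi /scal mmapC /= mmapC. Qed.

Lemma xtE (i : 'I_N) : xt k (enum_val i) = mon (jmonT i) U_(tagT i)%MM.
Proof. by []. Qed.

(** phi is a monomial map, so questions about it reduce to a comparison of exponents. *)
Lemma phi_mon tau xi : phi a (mon tau xi : S) = mon (xdeg tau xi) (tdeg tau).
Proof.
rewrite phiM {1}/phi mmapC /= mmapX.
have -> : mmap1 (fun i : 'I_N => xt k (enum_val i)) tau =
          mon (\sum_i jmonT i *+ tau i)%MM (tdeg tau) by rewrite -mmap1_mon.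
rewrite /phi mmapX /mmap1 (eq_bigr (fun i => (mon U_(i)%MM 0%MM : Rt) ^+ xi i)); last first.
  by move=> i _; rewrite /mon mpolyX0 mulr1.
rewrite -/(mmap1 _ _) mmap1_mon monM -multinomUE_id.
rewrite [X in mon _ (_ + X)%MM](_ : _ = 0%MM) ?addm0 1?addmC //.
by apply/mnmP => x; rewrite mnm_sumE mnm0E big1 // => i _; rewrite mulmnE mnm0E mul0n.
Qed.

(* The grading with x_i in degree 1 and t_l in degree -a_l: R(M) is its
   nonnegative part. *)
Definition wt u v : int := (mdeg u)%:Z - (\sum_l a l * v l)%N%:Z.

Lemma wtD u v u' v' : wt (u + u')%MM (v + v')%MM = wt u v + wt u' v'.
Proof.
rewrite /wt mdegD; have -> : (\sum_l a l * (v + v')%MM l =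
    \sum_l a l * v l + \sum_l a l * v' l)%N.
  by rewrite -big_split; apply: eq_bigr => l _; rewrite mnmDE mulnDr.
lia.
Qed.

Lemma wt0r u : wt u 0%MM = (mdeg u)%:Z.
Proof. by rewrite /wt big1 ?subr0 // => l _; rewrite mnm0E muln0. Qed.

Lemma wtU u l : wt u U_(l)%MM = (mdeg u)%:Z - (a l)%:Z.
Proof.
rewrite /wt (bigD1 l) //= big1 ?addn0 ?mnm1E ?eqxx ?muln1 // => i ne.
by rewrite mnm1E eq_sym (negPf ne) muln0.
Qed.

Hypothesis n_gt0 : (0 < n)%N.

Lemma mdeg_jmonT i : mdeg (jmonT i) = a (tagT i).
Proof. exact: mdeg_jmon. Qed.

(** Each variable T goes to a monomial of degree a_l times t_l, of weight 0. The weight therefore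
    recovers the x-degree in S. *)
Lemma wt_phi tau xi : wt (xdeg tau xi) (tdeg tau) = (mdeg xi)%:Z.
Proof.
rewrite /wt mdegD mdeg_sum.
have -> : (\sum_l a l * tdeg tau l = \sum_i a (tagT i) * tau i)%N.
  rewrite (eq_bigr (fun l => \sum_i a l * (U_(tagT i) *+ tau i)%MM l)%N); last first.
    by move=> l _; rewrite /tdeg mnm_sumE big_distrr.
  rewrite exchange_big; apply: eq_bigr => i _ /=.
  rewrite (bigD1 (tagT i)) //= big1 ?addn0; last first.
    by move=> l ne; rewrite mulmnE mnm1E eq_sym (negPf ne) muln0.
  by rewrite mulmnE mnm1E eqxx mul1n.
have -> : (\sum_i mdeg (jmonT i *+ tau i)%MM = \sum_i a (tagT i) * tau i)%N.
  by apply: eq_bigr => i _; rewrite mdegMn mdeg_jmonT.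
lia.
Qed.

Lemma jmonT_surj l u : mdeg u = a l -> exists i, tagT i = l /\ jmonT i = u.
Proof.
move=> /(jmon_surj n_gt0)[j <-].
by exists (enum_rank (Tagged (fun l => Jset n (a l)) j)); rewrite /tagT /jmonT enum_rankK.
Qed.

Lemma jmonT_inj i i' : tagT i = tagT i' -> jmonT i = jmonT i' -> i = i'.
Proof.
move=> ht hj; apply: enum_val_inj; move: ht hj; rewrite /tagT /jmonT.
case: (enum_val i) (enum_val i') => [l j] [l' j'] /= ll'; subst l'.
by move/(jmon_inj n_gt0) ->.
Qed.

(** Induction on the degree in t: if t_l occurs, nonnegative weight leaves at least a_l factors x_i,
    and a monomial of degree a_l among them pairs with t_l to give the image of one variable T. *)
Lemma phi_mon_surj u v : 0 <= wt u v ->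
  exists tau xi, xdeg tau xi = u /\ tdeg tau = v.
Proof.
elim: {v}(mdeg v) {-2}v (erefl (mdeg v)) u => [|e IHe] v dv u.
  by move/eqP: dv; rewrite mdeg_eq0 => /eqP -> _; exists 0%MM, u; rewrite xdegx tdeg0.
have [|l vl] := @mnm_gt0_exists _ v; first by rewrite dv.
move=> h; have h' : (a l)%:Z <= wt u (v - U_(l))%MM.
  by move: h; rewrite {1}(mnm_subK vl) -{1}[u]addm0 wtD wtU mdeg0; lia.
have le_au : (a l <= mdeg u)%N by move: h'; rewrite /wt; lia.
have [|w [_ le_wu dw]] := @mnm_between _ 0%MM u (a l) (lem1m u); first by rewrite mdeg0.
have [i [ti ji]] := jmonT_surj dw.
have [||tau [xi [h1 h2]]] := IHe (v - U_(l))%MM _ (u - w)%MM.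
- by move: dv; rewrite {1}(mnm_subK vl) mdegD mdeg1; lia.
- move: h'; rewrite -{1}(submK le_wu) -{1}[(v - U_(l))%MM]addm0 wtD wt0r dw; lia.
exists (tau + U_(i))%MM, xi; rewrite -[xi]addm0 xdegD tdegD xdegT tdegT.
by rewrite h1 h2 ti ji submK // -mnm_subK.
Qed.

Lemma phi_onto y : supp (fun u v => 0 <= wt u v) y -> exists F, y = phi a F.
Proof.
move=> hy; apply: (@nested_ind _ _ _ (fun y => exists F, y = phi a F)).
- by exists 0; rewrite phi0.
- by move=> _ _ [F ->] [G ->]; exists (F + G); rewrite phiD.
move=> u v /hy/phi_mon_surj[tau [xi [h1 h2]]].
by exists (scal y@_v@_u * mon tau xi); rewrite phiM phi_scal phi_mon h1 h2.
Qed.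

Lemma ReesMD y z : ReesM a y -> ReesM a z -> ReesM a (y + z).
Proof. exact: (@adjoin_add {mpoly k[n]} Rt _ y z). Qed.

Lemma ReesMM y z : ReesM a y -> ReesM a z -> ReesM a (y * z).
Proof. exact: (@adjoin_mul {mpoly k[n]} Rt _ y z). Qed.

Lemma ReesMC (w : {mpoly k[n]}) : ReesM a (w%:MP : Rt).
Proof. by rewrite -alg_mpolyC; apply: adjoin_scalar. Qed.

Lemma ReesM_phi F : ReesM a (phi a F).
Proof.
apply: (@nested_ind _ _ _ (fun F => ReesM a (phi a F))).
- by rewrite phi0 -mpolyC0; apply: ReesMC.
- by move=> G H hG hH; rewrite phiD; apply: ReesMD.
move=> tau xi _; rewrite phiM phi_scal phi_mon /xdeg.
have -> : mon (xi + \sum_i jmonT i *+ tau i)%MM (tdeg tau) =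
    ('X_[xi])%:MP * \prod_i (xt k (enum_val i)) ^+ tau i :> Rt.
  rewrite (eq_bigr (fun i => mon (jmonT i *+ tau i)%MM (U_(tagT i) *+ tau i)%MM)).
    by rewrite mon_sum /mon mpolyXD mpolyCM mulrA.
  by move=> i _; rewrite -mon_exp.
apply: ReesMM; first exact: ReesMC.
apply: ReesMM; first exact: ReesMC.
elim/big_ind: _ => [|y z|i _]; [by rewrite -mpolyC1; apply: ReesMC|exact: ReesMM|].
elim: (tau i) => [|e IHe]; first by rewrite expr0 -mpolyC1; apply: ReesMC.
by rewrite exprS; apply: ReesMM => //; apply: adjoin_gen; exists (enum_val i).
Qed.

(** Scalars and generators have nonnegative weight and the weight is additive; conversely each
    monomial of nonnegative weight lifts to S. *)
Lemma ReesM_supp y : ReesM a y <-> supp (fun u v => 0 <= wt u v) y.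
Proof.
split; last by case/phi_onto => F ->; apply: ReesM_phi.
elim=> {y} [c|_ [lj ->]|y z _ hy _ hz|y z _ hy _ hz].
- rewrite alg_mpolyC => u v; rewrite mcoeffC.
  by case: (v =P 0%MM) => [->|_]; rewrite ?wt0r // mulr0 mcoeff0 eqxx.
- by rewrite -(enum_rankK lj) xtE; apply: supp_mon; rewrite wtU mdeg_jmonT subrr.
- exact: suppD.
by apply: suppM hy hz => u v u' v'; rewrite wtD; apply: addr_ge0.
Qed.

Lemma ReesM_phiP y : ReesM a y <-> exists F, y = phi a F.
Proof. by split=> [/ReesM_supp/phi_onto//|[F ->]]; apply: ReesM_phi. Qed.

End Rees.

(** * The ideal L and its symbolic powers *)

Section PrincipalSymbolicPowers.
Variables (D : idomainType) (B L : D -> Prop) (x : D).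
Hypothesis B1 : B 1.
Hypotheses (x_neq0 : x <> 0) (Bx : B x).
Hypothesis x_prime : forall y s, (exists w, y * s = x * w) ->
  (exists w, y = x * w) \/ (exists w, s = x * w).
Hypothesis LP : forall y, L y <-> B y /\ exists w, y = x * w.
Hypothesis denom : forall y, exists s, [/\ B s, ~ L s & B (s * y)].

(** Primality of x moves one factor x at a time from the product into y. *)
Lemma prime_exp_dvd e y s z : y * s = x ^+ e * z -> ~ (exists w, s = x * w) ->
  exists w, y = x ^+ e * w.
Proof.
move=> def_y ns; elim: e y z def_y => [|e IHe] y z def_y.
  by exists y; rewrite mul1r.
have [|[w def_w]|//] := @x_prime y s.
  by exists (x ^+ e * z); rewrite def_y exprS mulrA.
have [|w' def_w'] := IHe w z; last by exists w'; rewrite def_w def_w' exprS mulrA.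
by move/eqP: x_neq0 => /mulfI; apply; rewrite mulrA -def_w def_y exprS mulrA.
Qed.

Lemma ideal_exp_dvd e y : ideal_exp B L e y -> exists z, y = x ^+ e * z.
Proof.
elim: e y => [|e IHe] /=; first by move=> y _; exists y; rewrite mul1r.
apply: ideal_gen_min => [|_ _ [y ->] [z ->]|r _ _ [u [v [/LP[_ [w ->]] /IHe[z ->] ->]]]].
- by exists 0; rewrite mulr0.
- by exists (y + z); rewrite mulrDr.
by exists (r * w * z); rewrite exprS; ring.
Qed.

Lemma ideal_exp_mem e y : B y -> ideal_exp B L e (x ^+ e * y).
Proof.
move=> hy; elim: e => [|e IHe] /=; first by rewrite mul1r.
rewrite exprS -mulrA -[x * _]mul1r; apply: ideal_gen_mem => //.
exists x, (x ^+ e * y); split=> //.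
by apply/LP; split=> //; exists 1; rewrite mulr1.
Qed.

(** The setting is L = xD \cap B with x prime in D, where any element of D enters B after
    multiplication by some s outside L. Such s cancel against x^e in one direction; in the other,
    x^e z is written as x^e (s z) / s. *)
Lemma principal_symbolic_power e y :
  symbolic_power B L e y <-> B y /\ exists z, y = x ^+ e * z.
Proof.
have nx1 : ~ exists w, 1 = x * w.
  move=> [w x1]; have [s [Bs + _]] := denom 0; apply; apply/LP; split=> //.
  by exists (w * s); rewrite mulrA -x1 mul1r.
split=> [[hy hs]|[hy [z def_y]]]; split=> //.
  (* Common denominators: elements of the extended ideal have the form x^e w / s with s not
     divisible by x, and primality of x preserves this form under sums. *)
  have [s [w [ns]]] : exists s w, ~ (exists w, s = x * w) /\
      tofrac y * tofrac s = tofrac (x ^+ e * w).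
    move: (tofrac y) hs; apply: ideal_gen_min.
    - by exists 1, 0; rewrite mul0r mulr0 rmorph0.
    - move=> q1 q2 [s1 [w1 [n1 h1]]] [s2 [w2 [n2 h2]]].
      exists (s1 * s2), (w1 * s2 + w2 * s1); split.
        by move=> [w def_w]; case: (x_prime (ex_intro _ w def_w)).
      rewrite mulrDr !mulrA rmorphD (rmorphM _ _ s2) (rmorphM _ _ s1) /= -h1 -h2 rmorphM /=.
      ring.
    move=> _ _ [r [s [hr hs ns ->]]] [u /ideal_exp_dvd[z ->] ->].
    exists s, (r * z); split; first by move=> h; apply: ns; apply/LP.
    have s0 : tofrac s != 0.
      rewrite tofrac_eq0; apply/eqP => s0; apply: ns; apply/LP; split=> //.
      by exists 0; rewrite mulr0.
    by rewrite mulrAC divfK // -rmorphM mulrCA.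
  rewrite -rmorphM => /eqP; rewrite tofrac_eq => /eqP def_y.
  exact: prime_exp_dvd def_y ns.
have [s [hs ns hsz]] := denom z.
have s_neq0 : tofrac s != 0.
  rewrite tofrac_eq0; apply/eqP => s0; apply: ns; apply/LP; split=> //.
  by exists 0; rewrite mulr0.
have -> : tofrac y = (tofrac 1 / tofrac s) * tofrac (x ^+ e * (s * z)).
  apply: (mulfI s_neq0); rewrite tofrac1 mul1r mulVKf // -rmorphM.
  by rewrite def_y; congr tofrac; ring.
apply: ideal_gen_mem; first by exists 1, s.
by exists (x ^+ e * (s * z)) => //; apply: ideal_exp_mem.
Qed.

End PrincipalSymbolicPowers.

(** * The matrix C and the prime ideal L *)

Section SymbolicPowers.
Variables (k : fieldType) (n : nat) (a : 'I_2 -> nat) (n_gt1 : (1 < n)%N).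
Let n_gt0 : (0 < n)%N := ltnW n_gt1.
Let i0 : 'I_n := Ordinal n_gt0.
Local Notation N := #|Tidx n a|.
Local Notation S := {mpoly {mpoly k[N]}[n]}.
Local Notation Rt := {mpoly {mpoly k[n]}[2]}.
Implicit Types (F G : S) (y z : Rt) (tau : 'X_{1..N}) (u xi : 'X_{1..n}) (v : 'X_{1..2}).

Definition x1 : Rt := mon U_(i0)%MM 0%MM.

Lemma xvarE s : xvar k a s = mon 0%MM U_(s)%MM :> S.
Proof. by rewrite /mon mpolyX0 mpolyC1 mul1r. Qed.

Lemma TvarE (lj : Tidx n a) : Tvar k lj = mon U_(enum_rank lj)%MM 0%MM :> S.
Proof. by rewrite /mon mpolyX0 mulr1. Qed.

Lemma phi_x1 : phi a (xvar k a i0) = x1.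
Proof. by rewrite xvarE phi_mon xdegx tdeg0. Qed.

Lemma Cmx0 s : Cmx k n a s ord0 = xvar k a s.
Proof. by rewrite mxE. Qed.

Lemma jmonT_dec (j : Tidx n a) (s : 'I_n) i : jpos (tagged j) ->
    enum_val i = Tagged (fun l => Jset n (a l)) (jdec (tagged j) s) ->
  (jmonT i + U_(i0) = jmon (tagged j) + U_(s))%MM /\ tagT i = tag j.
Proof. by move=> jp; rewrite /jmonT /tagT => ->; split=> //; apply: jmon_dec. Qed.

Lemma CmxS (c : 'I_(size (Ccols n a)).+1) (c_gt0 : (0 < c)%N) :
  exists2 lj : Tidx n a, Tidx' lj & forall s, Cmx k n a s c = Tvar_dec k lj s.
Proof.
case: c c_gt0 => [[|c] //= lt_c] _.
have [lj0 _] : exists lj0 : Tidx n a, true by case: (Ccols n a) lt_c => // lj0; exists lj0.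
exists (nth lj0 (Ccols n a) c) => [|s']; last by rewrite mxE /= (nth_map lj0).
have : nth lj0 (Ccols n a) c \in Ccols n a by rewrite mem_nth.
by rewrite mem_sort mem_enum.
Qed.

(** Each column of C becomes a monomial multiple of (x_1, ..., x_n), so the image of C has rank
    one. *)
Lemma phi_Cmx c : exists u v, forall s, phi a (Cmx k n a s c) = mon (u + U_(s))%MM v.
Proof.
case: (posnP c) => [c0|/CmxS[lj lj_pos CE]].
  have -> : c = ord0 by apply: val_inj.
  by exists 0%MM, 0%MM => s; rewrite Cmx0 xvarE phi_mon xdegx tdeg0 add0m.
exists (jmon (tagged lj) - U_(i0))%MM, U_(tag lj)%MM => s.
rewrite CE /Tvar_dec TvarE phi_mon xdegT tdegT.
have [h1 ->] := jmonT_dec lj_pos (enum_rankK (Tagged (fun l => Jset n (a l))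
  (jdec (tagged lj) s))).
congr mon; apply: (@addIm _ U_(i0)%MM); rewrite h1.
rewrite -addmA [(U_(s) + _)%MM]addmC addmA -mnm_subK //.
by rewrite -jposE.
Qed.

(** A variable T whose monomial is divisible by x_1 heads a column of C; row s of that column holds
    the variable with x_1 replaced by x_s. *)
Lemma Cmx_col (i : 'I_N) : (0 < jmonT i i0)%N -> exists c, forall s i',
    tagT i' = tagT i -> (jmonT i' + U_(i0) = jmonT i + U_(s))%MM ->
  Cmx k n a s c = mon U_(i')%MM 0%MM :> S.
Proof.
rewrite -jposE => jp.
have hi : enum_val i \in Ccols n a by rewrite mem_sort mem_enum.
have lt_c : ((index (enum_val i) (Ccols n a)).+1 < (size (Ccols n a)).+1)%N.
  by rewrite ltnS index_mem.
exists (Ordinal lt_c) => s i' ti' ji'.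
rewrite mxE /= (nth_map (enum_val i)) ?index_mem // nth_index // /Tvar_dec TvarE.
congr (mon U_(_)%MM 0%MM); apply/esym.
have [h1 h2] := jmonT_dec jp (enum_rankK (Tagged (fun l => Jset n (a l))
  (jdec (tagged (enum_val i)) s))).
apply: (jmonT_inj n_gt0); first by rewrite h2.
by apply: (@addIm _ U_(i0)%MM); rewrite h1.
Qed.

Lemma xdeg_gt0 tau xi s : (0 < xdeg tau xi s)%N ->
  (0 < xi s)%N \/ exists2 i, (0 < tau i)%N & (0 < jmonT i s)%N.
Proof.
rewrite /xdeg mnmDE addn_gt0 => /orP[|]; first by left.
rewrite mnm_sumE lt0n sum_nat_eq0 negb_forall => /existsP[i].
by rewrite /= mulmnE -lt0n muln_gt0 => /andP[h1 h2]; right; exists i.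
Qed.

Definition x1_div y := supp (fun u _ => (U_(i0) <= u)%MM) y.

(** A monomial of R(M) divisible by x_1 lifts to a monomial of S that contains x_1 itself or a
    variable T whose monomial involves x_1. Both are entries of the first row of C. *)
Lemma LidealP y : Lideal a y <-> ReesM a y /\ x1_div y.
Proof.
split=> [|[/(ReesM_supp a n_gt0) hy hdiv]].
  move: y; apply: ideal_gen_min => [|y z [h1 h2] [h3 h4]|z _ hz [s [c [s0 ->]]]].
  - by split; [apply/(ReesM_supp a n_gt0) | ]; apply: supp0.
  - by split; [exact: ReesMD | exact: suppD].
  split; first by apply: ReesMM => //; apply: ReesM_phi.
  have -> : s = i0 by apply: val_inj.
  have [u [v ->]] := phi_Cmx c.
  apply: (@suppM _ _ _ (fun _ _ => True) (fun u' _ => (U_(i0) <= u')%MM)) => //.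
    by move=> ? ? u' ? _ /lepm_trans; apply; apply: lem_addl.
  by apply: supp_mon; apply: lem_addl.
apply: (@nested_ind _ _ _ (Lideal a)) => [|y1 y2|u v nz].
- exact: ideal_gen0.
- exact: ideal_genD.
have /(phi_mon_surj n_gt0)[tau [xi [h1 h2]]] := hy _ _ nz.
have memL c F : Lideal a (phi a F * phi a (Cmx k n a i0 c)).
  by apply: ideal_gen_mem; [exact: ReesM_phi | exists i0, c].
have := hdiv _ _ nz; rewrite lep1mP -lt0n -h1 -h2 -phi_mon -(@phi_scal k n a) -phiM.
case/xdeg_gt0 => [xi0|[i ti ji]].
  rewrite (mnm_subK xi0) -[tau]addm0 -monM mulrA phiM -xvarE -Cmx0.
  exact: memL.
have [c Cc] := Cmx_col ji.
rewrite (mnm_subK ti) -[xi]addm0 -monM mulrA phiM -(Cc i0) //.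
Qed.

Lemma x1_divP y : x1_div y <-> exists z, y = x1 * z.
Proof.
split=> [/mon_dvd //|[z ->]].
apply: (@suppM _ _ _ (fun u' _ => (U_(i0) <= u')%MM) (fun _ _ => True)) => //.
  by move=> u' ? ? ? /lepm_trans h _; apply: h; apply: lem_addr.
by apply: supp_mon; apply: lepm_refl.
Qed.

(* Setting x_1 = 0 is a ring morphism with kernel (x_1): this is why x_1 is
   prime. *)
Definition kill_x1 : Rt -> Rt :=
  map_mpoly (mmap (@mpolyC n k) (fun i => if i == i0 then 0 else 'X_i)).

Lemma kill_mon u v : kill_x1 (mon u v) = if (0 < u i0)%N then 0 else mon u v.
Proof.
rewrite /kill_x1 rmorphM /= map_mpolyC /= map_mpolyX mmapX.
rewrite /mmap1; case: (posnP (u i0)) => [ui|ui].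
  rewrite /mon; congr (_%:MP * _); rewrite [RHS]mpolyXE_id.
  apply: eq_bigr => i _; case: (i =P i0) => [->|//]; by rewrite ui !expr0.
by rewrite (bigD1 i0) //= ?eqxx expr0n eqn0Ngt ui !mul0r.
Qed.

Lemma kill_scal (c : k) : kill_x1 (scal c) = scal c :> Rt.
Proof. by rewrite /kill_x1 /scal map_mpolyC /= mmapC. Qed.

Lemma kill_x1M y z : kill_x1 (y * z) = kill_x1 y * kill_x1 z.
Proof. exact: rmorphM. Qed.

Lemma kill_x1D y z : kill_x1 (y + z) = kill_x1 y + kill_x1 z.
Proof. exact: rmorphD. Qed.

Lemma kill_x1P y : kill_x1 y = 0 <-> exists z, y = x1 * z.
Proof.
split=> [|[z ->]]; last by rewrite kill_x1M kill_mon mnm1E eqxx mul0r.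
have [y1 [y2 [-> h1 h2]]] := supp_split (fun u _ => (U_(i0) <= u)%MM) y.
move: h1 => /x1_divP[z1 ->]; rewrite kill_x1D kill_x1M kill_mon mnm1E eqxx mul0r add0r.
suff -> : kill_x1 y2 = y2 by move=> ->; exists z1; rewrite addr0.
apply: (@nested_ind _ _ _ (fun y => kill_x1 y = y)) => [|y3 y4|u v /h2].
- exact: rmorph0.
- by rewrite kill_x1D => -> ->.
rewrite lep1mP negbK => ui.
by rewrite kill_x1M kill_scal kill_mon lt0n ui.
Qed.

Lemma x1_prime y z : x1_div (y * z) -> x1_div y \/ x1_div z.
Proof.
rewrite !x1_divP -!kill_x1P kill_x1M.
exact: nested_mulf_eq0.
Qed.

Lemma x1_neq0 : x1 <> 0.
Proof. exact: mon_neq0. Qed.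

Lemma ReesM_x1 : ReesM a x1.
Proof. by rewrite -phi_x1; apply: ReesM_phi. Qed.

(** Multiplication by x_2 raises the weight. All large exponents are allowed, so that a sum can use
    the maximum of two bounds. *)
Lemma ReesM_x2 y : exists e, forall e', (e <= e')%N ->
  ReesM a (mon (U_(Ordinal n_gt1) *+ e')%MM 0%MM * y).
Proof.
apply: (@nested_ind _ _ _ (fun y => exists e, forall e', (e <= e')%N -> ReesM a (mon _ _ * y))).
- by exists 0%N => e' _; rewrite mulr0 -mpolyC0; apply: ReesMC.
- move=> y1 y2 [e1 h1] [e2 h2]; exists (maxn e1 e2) => e'; rewrite geq_max => /andP[le1 le2].
  by rewrite mulrDr; apply: ReesMD; [exact: h1 | exact: h2].
move=> u v _; exists (\sum_l a l * v l)%N => e' le_e; apply/(ReesM_supp a n_gt0).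
rewrite mulrCA monM; apply: supp_term => _.
by rewrite wtD wt0r mdegMn mdeg1 /wt; lia.
Qed.

(** A power of x_2 works, being outside L because x_1 does not divide it; a second variable has to
    exist here. *)
Lemma L_denom y : exists s, [/\ ReesM a s, ~ Lideal a s & ReesM a (s * y)].
Proof.
have [e /(_ e (leqnn _)) hy] := ReesM_x2 y.
exists (mon (U_(Ordinal n_gt1) *+ e)%MM 0%MM); split=> //.
  by apply/(ReesM_supp a n_gt0); apply: supp_mon; rewrite /= wt0r.
case/LidealP => _ /(_ (U_(Ordinal n_gt1) *+ e)%MM 0%MM).
rewrite coef_mon !eqxx oner_neq0 => /(_ isT)/mnm_lepP/(_ i0).
by rewrite mnm1E eqxx mulmnE mnm1E.
Qed.

Lemma ReesM1 : ReesM a (1 : Rt).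
Proof. by rewrite -mpolyC1; apply: ReesMC. Qed.

Lemma x1_prime' y s : (exists w, y * s = x1 * w) ->
  (exists w, y = x1 * w) \/ (exists w, s = x1 * w).
Proof. by rewrite -!x1_divP; apply: x1_prime. Qed.

Lemma LidealP' y : Lideal a y <-> ReesM a y /\ exists w, y = x1 * w.
Proof. by rewrite -x1_divP; apply: LidealP. Qed.

Lemma symbolic_powerP e y : symbolic_power (ReesM a) (Lideal a) e y <->
  ReesM a y /\ exists z, y = x1 ^+ e * z.
Proof.
(* As in nested_mulf_eq0, conversion is left to the kernel. *)
unshelve epose proof
  (@principal_symbolic_power Rt (ReesM a) (Lideal a) x1 _ _ _ _ _ _ e y) as H.
- exact_no_check ReesM1.
- exact_no_check x1_neq0.
- exact_no_check ReesM_x1.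
- exact_no_check x1_prime'.
- exact_no_check LidealP'.
- exact_no_check L_denom.
exact_no_check H.
Qed.

End SymbolicPowers.

(** * The ideal of 2 x 2 minors *)

Lemma det_mx22 (A : comNzRingType) (M : 'M[A]_2) :
  \det M = M ord0 ord0 * M ord_max ord_max - M ord0 ord_max * M ord_max ord0.
Proof.
rewrite (expand_det_row _ ord0) big_ord2 /= /cofactor !det_mx11 !mxE /=.
rewrite expr0 expr1 mul1r mulN1r mulrN.
by congr (_ * M _ _ - _ * M _ _); apply: val_inj.
Qed.

Section KerPhi.
Variables (k : fieldType) (n : nat) (a : 'I_2 -> nat) (n_gt1 : (1 < n)%N).
Let n_gt0 : (0 < n)%N := ltnW n_gt1.
Let i0 : 'I_n := Ordinal n_gt0.
Local Notation N := #|Tidx n a|.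
Local Notation S := {mpoly {mpoly k[N]}[n]}.
Local Notation Rt := {mpoly {mpoly k[n]}[2]}.
Implicit Types (F G : S) (y z : Rt) (tau : 'X_{1..N}) (u xi : 'X_{1..n}) (v : 'X_{1..2}).

Definition I2 : S -> Prop := ideal_gen (@whole S) (is_minor 2 (Cmx k n a)).

Lemma I2D F G : I2 F -> I2 G -> I2 (F + G).
Proof. exact: ideal_genD. Qed.

Lemma I2M F G : I2 G -> I2 (F * G).
Proof. exact: whole_ideal_genM. Qed.

Lemma I2_0 : I2 0.
Proof. exact: ideal_gen0. Qed.

Lemma I2N F : I2 F -> I2 (- F).
Proof. by rewrite -mulN1r; apply: I2M. Qed.

(** Minors are indexed by increasing rows and columns; other orders only change the sign, and
    repeated indices give 0. *)
Lemma I2_minor s s' c c' :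
  I2 (Cmx k n a s c * Cmx k n a s' c' - Cmx k n a s c' * Cmx k n a s' c).
Proof.
have main (r r' : 'I_n) (e e' : 'I_(size (Ccols n a)).+1) : (r < r')%N -> (e < e')%N ->
    I2 (Cmx k n a r e * Cmx k n a r' e' - Cmx k n a r e' * Cmx k n a r' e).
  move=> lt_r lt_e; apply: whole_ideal_gen_mem.
  exists (pair2 r r'), (pair2 e e'); split.
  - by move=> i j; case: (ord2P i) => ->; case: (ord2P j) => ->.
  - by move=> i j; case: (ord2P i) => ->; case: (ord2P j) => ->.
  by rewrite det_mx22 !mxE.
have sub F G : F = G -> I2 G -> I2 F by move=> ->.
case: (ltngtP s s') => [lt_s|gt_s|/val_inj ->]; last first.
- by apply: (sub _ 0); [rewrite mulrC subrr | exact: I2_0].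
- case: (ltngtP c c') => [lt_c|gt_c|/val_inj ->].
  + by apply: sub (I2N (main _ _ _ _ gt_s lt_c)); ring.
  + by apply: sub (main _ _ _ _ gt_s gt_c); ring.
  by apply: (sub _ 0); [rewrite subrr | exact: I2_0].
case: (ltngtP c c') => [lt_c|gt_c|/val_inj ->].
- exact: main.
- by apply: sub (I2N (main _ _ _ _ lt_s gt_c)); ring.
by apply: (sub _ 0); [rewrite subrr | exact: I2_0].
Qed.

Lemma phi_I2 F : I2 F -> phi a F = 0.
Proof.
move: F; apply: ideal_gen_min => [|F G hF hG|F G _ [g [h [_ _ ->]]]].
- exact: phi0.
- by rewrite phiD hF hG addr0.
have subE i j : mxsub g h (Cmx k n a) i j = Cmx k n a (g i) (h j) by rewrite mxE.
rewrite phiM det_mx22 phiB !phiM !subE.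
have [u [v hu]] := phi_Cmx k n_gt1 (h ord0); have [u' [v' hu']] := phi_Cmx k n_gt1 (h ord_max).
rewrite !hu !hu' !monM.
suff -> : (u + U_(g ord0) + (u' + U_(g ord_max)) = u' + U_(g ord0) + (u + U_(g ord_max)))%MM.
  by rewrite [(v + v')%MM]addmC subrr mulr0.
by apply/mnmP => x; rewrite !mnmDE addnACA [RHS]addnACA [(u x + _)%N]addnC.
Qed.

Definition cong F G := I2 (F - G).

Lemma cong_refl F : cong F F.
Proof. by rewrite /cong subrr; apply: I2_0. Qed.

Lemma cong_trans F G H : cong F G -> cong G H -> cong F H.
Proof. by rewrite /cong => h1 h2; have := I2D h1 h2; rewrite addrA subrK. Qed.

Lemma congM F G H : cong G H -> cong (F * G) (F * H).
Proof. by rewrite /cong -mulrBr; apply: I2M. Qed.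

Lemma congD F G F' G' : cong F G -> cong F' G' -> cong (F + F') (G + G').
Proof. by rewrite /cong => h1 h2; rewrite opprD addrACA; apply: I2D. Qed.

Lemma cong_sum (T : Type) (s : seq T) (f g : T -> S) :
  (forall t, cong (f t) (g t)) -> cong (\sum_(t <- s) f t) (\sum_(t <- s) g t).
Proof.
move=> h; elim: s => [|t s IHs]; first by rewrite !big_nil; apply: cong_refl.
by rewrite !big_cons; apply: congD.
Qed.

Lemma cong_phi F G : cong F G -> phi a F = phi a G.
Proof. by move=> /phi_I2; rewrite phiB => /eqP; rewrite subr_eq0 => /eqP. Qed.

Lemma cong_deg tau xi tau' xi' : cong (mon tau xi) (mon tau' xi') ->
  xdeg tau xi = xdeg tau' xi' /\ tdeg tau = tdeg tau'.
Proof. by move/cong_phi; rewrite !phi_mon => /mon_inj. Qed.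

(** The variable i' arises from i by giving up x_r in exchange for x_s, with the same l. *)
Definition trade r s (i i' : 'I_N) :=
  tagT i' = tagT i /\ (jmonT i' + U_(r) = jmonT i + U_(s))%MM.

Lemma trade_exists r s (i : 'I_N) : (0 < jmonT i r)%N -> exists i', trade r s i i'.
Proof.
move=> ir; have [|i' [h1 h2]] := @jmonT_surj n a n_gt0 (tagT i) (jmonT i - U_(r) + U_(s))%MM.
  by rewrite -mdeg_jmonT // {2}(mnm_subK ir) !mdegD !mdeg1.
exists i'; split=> //; rewrite h2 -addmA [(U_(s) + _)%MM]addmC addmA -mnm_subK //.
Qed.

(** Columns are indexed through their first row. Trading x_r for x_1 gives the head of a column that
    contains i in row r and the trade of i for x_s in row s. *)
Lemma Cmx_col_trade r (i : 'I_N) : (0 < jmonT i r)%N -> exists c, forall s i',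
  trade r s i i' -> Cmx k n a s c = mon U_(i')%MM 0%MM :> S.
Proof.
move=> ir; have [j [tj jj]] := trade_exists i0 ir.
have jj' : jmonT j = (jmonT i - U_(r) + U_(i0))%MM.
  by apply: (@addIm _ U_(r)%MM); rewrite jj -addmA [(U_(i0) + _)%MM]addmC addmA -mnm_subK.
have [|c Cc] := @Cmx_col k n a n_gt1 j.
  by rewrite jj' mnmDE mnm1E eqxx addn1.
exists c => s i' [ti' ji']; apply: Cc; first by rewrite ti' tj.
apply/mnmP => x; have /mnmP/(_ x) := ji'; have /mnmP/(_ x) := jj.
by rewrite !mnmDE -/n_gt0 -/i0; lia.
Qed.

Lemma trade_refl r (i : 'I_N) : trade r r i i.
Proof. by []. Qed.

(** The difference is a minor formed with the first column of C. *)
Lemma cong_trade_x r s (i i' : 'I_N) : (0 < jmonT i r)%N -> trade r s i i' ->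
  cong (mon U_(i)%MM U_(s)%MM) (mon U_(i')%MM U_(r)%MM).
Proof.
move=> ir hi; have [c Cc] := Cmx_col_trade ir.
have := I2_minor r s c ord0; rewrite (Cc _ _ hi) (Cc _ _ (trade_refl r i)) !Cmx0 !xvarE.
by rewrite !monM !addm0 !add0m.
Qed.

Lemma cong_trade_T r s (i i' j j' : 'I_N) :
    (0 < jmonT i r)%N -> trade r s i i' -> (0 < jmonT j s)%N -> trade s r j j' ->
  cong (mon (U_(i) + U_(j))%MM 0%MM) (mon (U_(i') + U_(j'))%MM 0%MM).
Proof.
move=> ir hi js hj; have [c Cc] := Cmx_col_trade ir; have [e Ce] := Cmx_col_trade js.
have := I2_minor r s c e; rewrite (Cc _ _ hi) (Cc _ _ (trade_refl r i)).
rewrite (Ce _ _ hj) (Ce _ _ (trade_refl s j)) !monM !addm0.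
by rewrite [(U_(j') + _)%MM]addmC.
Qed.

Lemma mnm_neq_lt m (u v : 'X_{1..m}) : mdeg u = mdeg v -> u <> v ->
  exists i, (u i < v i)%N.
Proof.
move=> duv ne; apply/existsP; apply: contra_notT ne.
rewrite negb_exists => /forallP h.
have le_vu : (v <= u)%MM by apply/mnm_lepP => i; rewrite leqNgt h.
have := duv; rewrite -{1}(submK le_vu) mdegD -[RHS]add0n => /addIn/eqP.
by rewrite mdeg_eq0 => /eqP h0; rewrite -(submK le_vu) h0 add0m.
Qed.

(* Induction on the degree of jmonT i - jmonT j, which each trade lowers. *)
Lemma cong_move (i j : 'I_N) tau xi : tagT j = tagT i -> (0 < tau j)%N ->
  (jmonT i <= xdeg tau xi)%MM ->
  exists tau' xi', (0 < tau' i)%N /\ cong (mon tau xi) (mon tau' xi').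
Proof.
elim: {j}(mdeg (jmonT i - jmonT j)).+1 {-2}j (ltnSn (mdeg (jmonT i - jmonT j))) tau xi.
  by [].
move=> D IHD j ltD tau xi tj tauj le_i.
case: (eqVneq (jmonT j) (jmonT i)) => [jj|/eqP ne].
  have eq_ji := jmonT_inj n_gt0 tj jj.
  by exists tau, xi; rewrite -{1}eq_ji; split; [exact: tauj | exact: cong_refl].
have dd : mdeg (jmonT j) = mdeg (jmonT i) by rewrite !mdeg_jmonT ?tj.
(* x_s is lacking in j compared with i and x_r is in excess, so trading x_r for x_s brings j closer
   to i. *)
have [s lt_s] := mnm_neq_lt dd ne.
have [r lt_r] := mnm_neq_lt (esym dd) (fun h => ne (esym h)).
have jr : (0 < jmonT j r)%N by apply: leq_trans lt_r.
have [j' hj] := trade_exists s jr.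
suff [tau' [xi' [tau'j' cg]]] : exists tau' xi', (0 < tau' j')%N /\
    cong (mon tau xi) (mon tau' xi').
  have [|||tau2 [xi2 [h1 h2]]] := IHD j' _ tau' xi' _ tau'j'.
  - rewrite -ltnS; apply: leq_trans ltD; rewrite ltnS.
    suff -> : (jmonT i - jmonT j = jmonT i - jmonT j' + U_(s))%MM.
      by rewrite mdegD mdeg1 addn1.
    apply/mnmP => x; have /mnmP/(_ x) := hj.2.
    rewrite !(mnmDE, mnmBE, mnm1E).
    have lt_sx : s = x -> (jmonT j x < jmonT i x)%N by move=> <-.
    have lt_rx : r = x -> (jmonT i x < jmonT j x)%N by move=> <-.
    by case: (s =P x) => [/lt_sx|_]; case: (r =P x) => [/lt_rx|_]; rewrite /nat_of_bool; lia.
  - by rewrite hj.1.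
  - by have [<- _] := cong_deg cg.
  by exists tau2, xi2; split; [exact: h1 | exact: (cong_trans cg h2)].
have def_tau := mnm_subK tauj; set tau0 := (tau - U_(j))%MM in def_tau.
(* The monomial of i divides the whole image but j has too few x_s, so the remaining factors supply
   one: either x_s itself or another variable j1, which receives x_r in return. *)
have : (0 < xdeg tau0 xi s)%N.
  have /mnm_lepP/(_ s) := le_i; rewrite def_tau -{1}[xi]addm0 xdegD xdegT mnmDE.
  by move: lt_s; case: (xdeg tau0 xi s) => //; rewrite add0n; lia.
case/xdeg_gt0 => [xis|[j1 tj1 j1s]].
  exists (tau0 + U_(j'))%MM, (xi - U_(s) + U_(r))%MM; split.
    by rewrite mnmDE mnm1E eqxx addn1.
  rewrite def_tau {1}(mnm_subK xis) -!monM; apply: congM; exact: cong_trade_x.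
have [j1' hj1] := trade_exists r j1s.
exists (tau0 - U_(j1) + (U_(j') + U_(j1')))%MM, xi; split.
  by rewrite !mnmDE mnm1E eqxx; lia.
rewrite def_tau {1}(mnm_subK tj1) -addmA -[xi]addm0 -!monM; apply: congM.
by rewrite [(U_(j1) + _)%MM]addmC; apply: cong_trade_T hj1.
Qed.

(** Induction on the T-degree: [cong_move] makes a variable of tau' appear in the other monomial,
    and this common factor is then split off. *)
Lemma cong_mon tau xi tau' xi' : xdeg tau xi = xdeg tau' xi' ->
  tdeg tau = tdeg tau' -> cong (mon tau xi) (mon tau' xi').
Proof.
elim: {tau'}(mdeg tau') {-2}tau' (erefl (mdeg tau')) tau xi xi' =>
  [|e IHe] tau' dtau' tau xi xi' hx ht.
  move: hx; have -> : tau = 0%MM.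
    by apply/eqP; rewrite -mdeg_eq0 -mdeg_tdeg ht mdeg_tdeg dtau'.
  have -> : tau' = 0%MM by apply/eqP; rewrite -mdeg_eq0 dtau'.
  by rewrite !xdegx => ->; apply: cong_refl.
have [|i taui] := @mnm_gt0_exists _ tau'; first by rewrite dtau'.
have [j tj tauj] : exists2 j, tagT j = tagT i & (0 < tau j)%N.
  have : (0 < tdeg tau (tagT i))%N.
    by rewrite ht (mnm_subK taui) tdegD tdegT mnmDE mnm1E eqxx addn1.
  rewrite mnm_sumE lt0n sum_nat_eq0 negb_forall => /existsP[j].
  rewrite /= mulmnE mnm1E -lt0n muln_gt0 lt0b => /andP[/eqP tj tauj].
  by exists j.
have [|tau1 [xi1 [tau1i cg]]] := @cong_move i j tau xi tj tauj.
  rewrite hx (mnm_subK taui) -[xi']addm0 xdegD xdegT; exact: lem_addl.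
have [hx1 ht1] := cong_deg cg; apply: (cong_trans cg).
rewrite (mnm_subK tau1i) {1}(mnm_subK taui) -[xi1]addm0 -[xi']addm0.
rewrite [(tau1 - _ + _)%MM]addmC [(tau' - _ + _)%MM]addmC.
rewrite [(xi1 + _)%MM]addmC [(xi' + _)%MM]addmC -!monM; apply: congM; apply: IHe.
- by move: dtau'; rewrite {1}(mnm_subK taui) mdegD mdeg1 addn1 => -[].
- move: hx; rewrite hx1 {1}(mnm_subK tau1i) {1}(mnm_subK taui).
  by rewrite -[xi1]addm0 -[xi']addm0 !xdegD xdegT => /addIm; rewrite !addm0.
by move: ht; rewrite ht1 {1}(mnm_subK tau1i) {1}(mnm_subK taui) !tdegD => /addIm.
Qed.

(** One representative for each fibre of phi on monomials; the value is unspecified over exponents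
    outside the image. *)
Let section (w : 'X_{1..n} * 'X_{1..2}) : 'X_{1..N} * 'X_{1..n} :=
  epsilon (inhabits (0%MM, 0%MM))
    (fun t => (xdeg t.1 t.2, tdeg t.1) = w).
Let im (t : 'X_{1..N} * 'X_{1..n}) := (xdeg t.1 t.2, tdeg t.1).

Lemma im_section t : im (section (im t)) = im t.
Proof. exact: (epsilon_spec _ (fun t' => im t' = im t) (ex_intro _ t erefl)). Qed.

(* Choosing one monomial over each monomial of R(M) changes F by an element
   of I_2(C), and turns it into 0 when phi F = 0. *)
Lemma ker_phi F : phi a F = 0 -> I2 F.
Proof.
pose s := [seq (tau, xi) | xi <- msupp F, tau <- msupp F@_xi].
pose c (t : 'X_{1..N} * 'X_{1..n}) := F@_t.2@_t.1.
pose f t : S := scal (c t) * mon t.1 t.2.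
pose g t : S := scal (c t) * mon (section (im t)).1 (section (im t)).2.
have def_F : F = \sum_(t <- s) f t.
  by rewrite {1}[F]nested_expand big_allpairs_dep.
move=> phiF0; pose G := \sum_(t <- s) g t.
have cgF : cong F G.
  rewrite {1}def_F; apply: cong_sum => t; apply: congM; apply: cong_mon.
    exact: (esym (congr1 fst (im_section t))).
  exact: (esym (congr1 snd (im_section t))).
suff G0 : G = 0 by have := cgF; rewrite /cong G0 subr0.
apply/mpolyP => xi; apply/mpolyP => tau; rewrite !mcoeff0.
pose w := im (tau, xi).
(* The coefficient of [phi a F] at w is the sum of the coefficients of F over the fibre of w. *)
have sum0 : \sum_(t <- s | im t == w) c t = 0.
  have E := congr1 (fun y => y@_w.2@_w.1) phiF0; rewrite !mcoeff0 in E.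
  rewrite -[RHS]E def_F phi_sum !raddf_sum /= big_mkcond; apply: eq_bigr => t _.
  rewrite /f phiM phi_scal phi_mon coef_scal_mon [im t == w]/eq_op /= andbC.
  by case: (_ && _).
rewrite /G !raddf_sum /=.
(* Hence G has this fibre sum as its coefficient at a chosen representative, and 0 at every other
   monomial. *)
have section_eq t : ((section (im t)).2 == xi) && ((section (im t)).1 == tau) =
    (im t == w) && (section w == (tau, xi)).
  rewrite andbC -xpair_eqE -surjective_pairing.
  apply/eqP/andP => [st|[/eqP -> /eqP //]].
  have imt : im t = w by rewrite -im_section st.
  by rewrite -imt st !eqxx.
case: (boolP (section w == (tau, xi))) => sw.
  rewrite -[RHS]sum0 [RHS]big_mkcond; apply: eq_bigr => t _.
  by rewrite /g coef_scal_mon section_eq sw andbT; case: (_ == _).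
rewrite big1 // => t _.
by rewrite /g coef_scal_mon section_eq (negPf sw) andbF.
Qed.

End KerPhi.

(** * The ideal A R(M) *)

Lemma supp_CX (k : fieldType) p q (Q : 'X_{1..p} -> 'X_{1..q} -> Prop)
    (w : {mpoly k[p]}) v0 :
  (forall u, u \in msupp w -> Q u v0) -> supp Q (w%:MP * 'X_[v0]).
Proof.
move=> hw u v; rewrite mcoeffCM mcoeffX; case: (v0 =P v) => [<-|_].
  by rewrite mulr1 -mcoeff_msupp; apply: hw.
by rewrite mulr0 mcoeff0 eqxx.
Qed.

Section Koszul.
Variables (k : fieldType) (n : nat) (a : 'I_2 -> nat) (n_gt1 : (1 < n)%N).
Variables (f : 'I_2 -> {mpoly k[n]}) (df : 'I_2 -> nat) (d : nat).
Let n_gt0 : (0 < n)%N := ltnW n_gt1.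
Local Notation N := #|Tidx n a|.
Local Notation S := {mpoly {mpoly k[N]}[n]}.
Local Notation Rt := {mpoly {mpoly k[n]}[2]}.
Implicit Types (F G : S) (y z r : Rt) (tau : 'X_{1..N}) (u m : 'X_{1..n}) (v : 'X_{1..2}).

Hypothesis f0_neq0 : f ord0 <> 0.
Hypothesis f1_reg : forall w,
  (exists w', f ord_max * w = w' * f ord0) -> exists w', w = w' * f ord0.
Hypothesis f_homog : forall l, f l \is (df l).-homog.
Hypothesis a_df : forall l, (a l + df l)%N = d.

Local Notation g := (koszul f).

Definition wtg : int := (df ord0 + df ord_max)%N%:Z - d%:Z.

(** On monomials of R(M) this is the bidegree induced from S, extended to all of R[t_1, t_2]. *)
Definition bideg u v : int * int := (wt a u v, (mdeg v)%:Z).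

Lemma bidegD u v u' v' :
  bideg (u + u')%MM (v + v')%MM = bideg u v + bideg u' v'.
Proof. by rewrite /bideg wtD mdegD PoszD. Qed.

Lemma koszul_homog : supp (fun u v => bideg u v = (wtg, 1)) g.
Proof.
have f_deg l u : u \in msupp (f l) -> mdeg u = df l.
  exact: (dhomog_mf (f_homog l)).
apply: suppB; apply: supp_CX => u /f_deg du; rewrite /bideg wtU mdeg1 du /wtg.
  by congr pair; rewrite -(a_df ord_max); lia.
by congr pair; rewrite -(a_df ord0); lia.
Qed.

Lemma koszul_neq0 : g <> 0.
Proof.
move=> /(congr1 (fun y => y@_U_(ord_max))); rewrite mcoeff0 mcoeffB !mcoeffCM !mcoeffXU /=.
by rewrite mulr1 mulr0 subr0.
Qed.

Definition Wt (z : int) y := supp (fun u v => z <= wt a u v) y.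

Lemma WtM (z z' : int) y y' : Wt z y -> Wt z' y' -> Wt (z + z') (y * y').
Proof. by apply: suppM => u v u' v'; rewrite wtD; lia. Qed.

Lemma Wt_weak (z z' : int) y : z' <= z -> Wt z y -> Wt z' y.
Proof. by move=> le_z; apply: supp_sub => u v; apply: le_trans. Qed.

Lemma Wt_mon u v : Wt (wt a u v) (mon u v : Rt).
Proof. by apply: supp_mon. Qed.

Lemma Wt_koszul : Wt wtg g.
Proof. by apply: supp_sub koszul_homog => u v [->]. Qed.

Lemma Wt_divr (z w0 w1 : int) r y : r <> 0 ->
  supp (fun u v => bideg u v = (w0, w1)) r -> Wt z (r * y) -> Wt (z - w0) y.
Proof.
move=> r0 hr hry.
apply: (supp_sub _ (@supp_homog_divr k n 2 _ bideg (w0, w1) (fun b => z <= b.1)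
  r y bidegD r0 hr hry)).
by move=> u v /=; lia.
Qed.

Lemma ReesM_Wt y : ReesM a y <-> Wt 0 y.
Proof. exact: ReesM_supp. Qed.

Local Notation ARM := (image_of (phi a) (ker_chi a f)).

(** A R(M) is the part of ker Psi inside R(M). The kernel is generated by g, and as g is homogeneous
    and nonzero, the bound on the weight of g w passes to w. *)
Lemma ARM_P y : ARM y <-> exists2 w, y = g * w & Wt (- wtg) w.
Proof.
split=> [[F hF ->]|[w -> hw]].
  have [w def_w] : exists w, phi a F = g * w.
    apply: (@Psi_ker k n f _ f1_reg (msize (phi a F))).
    - exact/eqP.
    - by move=> v; rewrite -mcoeff_msupp; apply: msize_mdeg_lt.
    exact: hF.
  exists w => //; rewrite -[- wtg]add0r.
  apply: (Wt_divr koszul_neq0 koszul_homog); rewrite -def_w.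
  by apply/ReesM_Wt; apply: ReesM_phi.
have [|F hF] := @phi_onto k n a n_gt0 (g * w).
  by have := WtM Wt_koszul hw; rewrite subrr.
exists F; last by rewrite hF.
by rewrite /ker_chi /chi -hF PsiM Psi_koszul mul0r.
Qed.

(* Psi sends x^u t^v to a homogeneous form of degree wt u v + d |v| times
   t^|v|. *)
Lemma Psi_wt (Q : int -> Prop) y : supp (fun u v => Q (wt a u v)) y ->
  forall i m, m \in msupp (Psi f y)`_i -> Q ((mdeg m)%:Z - (d * i)%N%:Z).
Proof.
move=> hy; apply: (@nested_ind _ _ _ (fun y => forall i m,
  m \in msupp (Psi f y)`_i -> Q ((mdeg m)%:Z - (d * i)%N%:Z))).
- by move=> i m; rewrite Psi0 coef0 msupp0.
- move=> y1 y2 h1 h2 i m; rewrite PsiD coefD => /msuppD_le.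
  by rewrite mem_cat => /orP[/h1|/h2].
move=> u v nz i m.
have -> : scal y@_v@_u * mon u v = (y@_v@_u *: 'X_[u])%:MP * 'X_[v] :> Rt.
  by rewrite /scal /mon -mul_mpolyC mpolyCM mulrA.
rewrite PsiM PsiC coefCM.
have -> : Psi f 'X_[v] = (f ord0 ^+ v ord0 * f ord_max ^+ v ord_max) *: 'X^(mdeg v).
  rewrite /Psi mmapX /mmap1 big_ord2 /= !exprZn -scalerAl -scalerAr scalerA -exprD.
  by rewrite mdegE big_ord2.
rewrite coefZ coefXn; case: eqP => [->|_]; last by rewrite !mulr0 msupp0.
rewrite mulr1 => hm; have := hy _ _ nz.
have hom : y@_v@_u *: 'X_[u] * (f ord0 ^+ v ord0 * f ord_max ^+ v ord_max)
    \is (mdeg u + (df ord0 * v ord0 + df ord_max * v ord_max)).-homog.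
  apply: dhomogM; first by apply: dhomogZ; rewrite dhomogX.
  by apply: dhomogM; apply: dhomogMn.
rewrite (dhomog_mf hom hm) /wt big_ord2 /= [mdeg v]mdegE big_ord2 /=.
suff -> : ((mdeg u)%:Z - (a ord0 * v ord0 + a ord_max * v ord_max)%N%:Z) =
  (mdeg u + (df ord0 * v ord0 + df ord_max * v ord_max))%N%:Z
     - (d * (v ord0 + v ord_max))%N%:Z by [].
by rewrite mulnDr -{1}(a_df ord0) -(a_df ord_max) !mulnDl; lia.
Qed.

Local Notation J := (truncation (ideal_gen (@whole _)
  (fun p => p \in [:: f ord0; f ord_max])) d).

Lemma ReesI_P (p : {poly {mpoly k[n]}}) : ReesI J p <-> exists F, chi a f F = p.
Proof.
split=> [|[F <-]].
  suff h1 : ReesI J p -> exists2 z, ReesM a z & Psi f z = p.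
    by move=> /h1[z /(ReesM_phiP a n_gt0)[F ->] hF]; exists F.
  elim=> {p} [w|_ [w [hw hd] ->]|y z _ [y' hy <-] _ [z' hz <-]|y z _ [y' hy <-] _ [z' hz <-]].
  - exists (w%:MP); [exact: ReesMC | by rewrite PsiC alg_polyC].
  - have [w0 [w1 def_w]] : exists w0 w1, w = w0 * f ord0 + w1 * f ord_max.
      move: w hw {hd}; apply: ideal_gen_min => [|_ _ [w0 [w1 ->]] [w0' [w1' ->]]|w w' _].
      - by exists 0, 0; rewrite !mul0r addr0.
      - by exists (w0 + w0'), (w1 + w1'); ring.
      rewrite !inE => /orP[]/eqP ->; first by exists w, 0; rewrite mul0r addr0.
      by exists 0, w; rewrite mul0r add0r.
    pose z : Rt := w0%:MP * 'X_ord0 + w1%:MP * 'X_ord_max.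
    have Psi_z : Psi f z = w *: 'X.
      by rewrite PsiD !PsiM !PsiC !PsiX def_w -!mul_polyC; rewrite polyCD !polyCM; ring.
    have [z1 [z2 [def_z hz1 hz2]]] := supp_split (fun u v => 0 <= wt a u v) z.
    exists z1; first exact/ReesM_Wt.
    suff Psi_z2 : Psi f z2 = 0 by rewrite -Psi_z def_z PsiD Psi_z2 addr0.
    (* In front of t^i, monomials of [Psi f z2] have degree < d i, whereas those of w t and of
       [Psi f z1] have degree >= d i. *)
    apply/polyP => i; apply/mpolyP => m; rewrite coef0 mcoeff0.
    apply/eqP; apply: contraT; rewrite -mcoeff_msupp => mz2.
    have := @Psi_wt (fun b : int => ~~ (0 <= b)) z2 hz2 i m mz2; rewrite -ltNge => lt_m.
    have : m \in msupp (w *: 'X - Psi f z1)`_i by rewrite -Psi_z def_z PsiD addrC addKr.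
    rewrite coefB => /msuppB_le; rewrite mem_cat.
    case/orP=> [|/(@Psi_wt (fun b : int => 0 <= b) z1 hz1)]; last by lia.
    rewrite coefZ coefX; case: eqP => [i1|_]; last by rewrite mulr0 msupp0.
    by rewrite mulr1 => /hd; move: lt_m; rewrite i1 muln1; lia.
  - by exists (y' + z'); [exact: ReesMD | exact: PsiD].
  by exists (y' * z'); [exact: ReesMM | exact: PsiM].
rewrite /chi; elim: (ReesM_phi F) => {F} [w|_ [lj ->]|y z _ hy _ hz|y z _ hy _ hz].
- rewrite alg_mpolyC PsiC -alg_polyC; exact: adjoin_scalar.
- have -> : Psi f (xt k lj) = ('X_[jmon (tagged lj)] * f (tag lj)) *: 'X.
    by rewrite PsiM PsiC PsiX mul_polyC scalerA.
  apply: adjoin_gen; eexists; last by [].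
  split=> [|m].
    by apply: ideal_gen_mem => //; case: (ord2P (tag lj)) => ->; rewrite !inE eqxx ?orbT.
  move=> hm; have hX : ('X_[jmon (tagged lj)] : {mpoly k[n]}) \is (a (tag lj)).-homog.
    by rewrite dhomogX; apply/eqP; apply: mdeg_jmon.
  by rewrite (dhomog_mf (dhomogM hX (f_homog (tag lj))) hm) a_df.
- rewrite PsiD; exact: (@adjoin_add _ {poly {mpoly k[n]}} _ _ _ hy hz).
rewrite PsiM; exact: (@adjoin_mul _ {poly {mpoly k[n]}} _ _ _ hy hz).
Qed.

Lemma bihomogP p q F : bihomog p q F <->
  supp (fun tau xi => (mdeg xi)%:Z = p /\ (mdeg tau)%:Z = q) F.
Proof.
split=> [hF tau xi nz|hF xi xiF].
  have xiF : xi \in msupp F.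
    by rewrite mcoeff_msupp; apply: contraNneq nz => ->; rewrite mcoeff0.
  by have [-> hq] := hF _ xiF; split=> //; apply: hq; rewrite mcoeff_msupp.
split=> [|tau]; last by rewrite mcoeff_msupp => /hF[].
have /mlead_supp : F@_xi != 0 by rewrite -mcoeff_msupp.
by rewrite mcoeff_msupp => /hF[].
Qed.

Lemma ReesM_bidegP p q y : ReesM_bideg a p q y <->
  ReesM a y /\ supp (fun u v => bideg u v = (p, q)) y.
Proof.
split=> [[F /bihomogP hF ->]|[/ReesM_Wt hy hpq]].
  split; first exact: ReesM_phi.
  apply: (@nested_ind _ _ _ (fun F => supp _ (phi a F))).
  - by rewrite phi0; apply: supp0.
  - by move=> F1 F2 h1 h2; rewrite phiD; apply: suppD.
  move=> tau xi /hF[dxi dtau]; rewrite phiM phi_scal phi_mon; apply: supp_term => _.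
  by rewrite /bideg wt_phi // mdeg_tdeg dxi dtau.
apply: (@nested_ind _ _ _ (ReesM_bideg a p q)).
- by exists 0; [apply/bihomogP; apply: supp0 | rewrite phi0].
- move=> _ _ [F1 /bihomogP h1 ->] [F2 /bihomogP h2 ->]; exists (F1 + F2); last by rewrite phiD.
  by apply/bihomogP; apply: suppD.
move=> u v nz; have [tau [xi [du dv]]] := phi_mon_surj n_gt0 (hy _ _ nz).
exists (scal y@_v@_u * mon tau xi); last by rewrite phiM phi_scal phi_mon du dv.
apply/bihomogP; apply: supp_term => _; have := hpq _ _ nz.
by rewrite /bideg -{1}du -dv wt_phi // mdeg_tdeg => -[].
Qed.

(** They stand for the positive and negative parts of [wtg]: delta is the exponent of x_1 and L, and
    e the degree of the monomials indexing the forms h. *)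
Variables delta e : nat.
Hypothesis delta_e : wtg = delta%:Z - e%:Z.

Local Notation x1 := (x1 k n_gt1).
Local Notation Symb := (symbolic_power (ReesM a) (Lideal a) delta).

Lemma x1_expE : x1 ^+ delta = mon (U_(Ordinal n_gt0) *+ delta)%MM 0%MM.
Proof.
rewrite mon_exp; congr (mon _ _).
by apply/mnmP => i; rewrite mulmnE mnm0E mul0n.
Qed.

Lemma x1_exp_neq0 : x1 ^+ delta <> 0.
Proof. by rewrite x1_expE; apply: mon_neq0. Qed.

Lemma x1_exp_homog :
  supp (fun u v => bideg u v = (delta%:Z, 0)) (x1 ^+ delta).
Proof.
rewrite x1_expE; apply: supp_mon.
by rewrite /bideg wt0r mdegMn mdeg1 mdeg0 mul1n.
Qed.

Lemma Wt_x1_exp : Wt delta (x1 ^+ delta).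
Proof. by apply: supp_sub x1_exp_homog => u v [->]. Qed.

(** The analogue of [ARM_P] with x_1^delta in place of g. *)
Lemma Symb_P y : Symb y <-> exists2 w, y = x1 ^+ delta * w & Wt (- delta%:Z) w.
Proof.
rewrite (symbolic_powerP a n_gt1); split=> [[hy [w def_y]]|[w -> hw]].
  exists w => //; rewrite -[- _]add0r; apply: (Wt_divr x1_exp_neq0 x1_exp_homog).
  by rewrite -def_y; apply/ReesM_Wt.
split; last by exists w.
by apply/ReesM_Wt; have := WtM Wt_x1_exp hw; rewrite subrr.
Qed.

Let quot y : Rt := epsilon (inhabits 0) (fun w => y = g * w).

Lemma quotK w : quot (g * w) = w.
Proof.
have hq : g * w = g * quot (g * w).
  exact: (epsilon_spec (inhabits 0) (fun w' => g * w = g * w') (ex_intro _ w erefl)).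
exact: (esym (nested_mulfI koszul_neq0 hq)).
Qed.

(** The isomorphism replaces the factor g by x_1^delta. Both have weight delta when e = 0, but g has
    degree 1 in t and x_1^delta has degree 0, whence the shift. *)
Lemma ARM_iso : e = 0%N -> bigraded_iso a ARM Symb 0 (-1).
Proof.
move=> e0; have dg : wtg = delta by rewrite delta_e e0 subr0.
have SymbE w : Wt (- wtg) w -> Symb (x1 ^+ delta * w).
  by move=> hw; apply/Symb_P; exists w; [|rewrite -dg].
exists (fun y => x1 ^+ delta * quot y); split.
- move=> r _ _ _ /ARM_P[w -> _] /ARM_P[w' -> _].
  have -> : r * (g * w) + g * w' = g * (r * w + w') by ring.
  by rewrite !quotK; ring.
- by move=> _ /ARM_P[w -> hw]; rewrite quotK; apply: SymbE.
- move=> _ _ /ARM_P[w -> hw] /ARM_P[w' -> hw']; rewrite !quotK => h1.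
  by rewrite (nested_mulfI x1_exp_neq0 h1).
- move=> _ /Symb_P[w -> hw]; exists (g * w); last by rewrite quotK.
  by apply/ARM_P; exists w; [|rewrite dg].
move=> p q _ /ARM_P[w -> hw] /ReesM_bidegP[_ hpq]; rewrite quotK.
apply/ReesM_bidegP; split.
  by have /(symbolic_powerP a n_gt1)[] := SymbE _ hw.
have hpq' : supp (fun u v => bideg u v == (p, q)) (g * w).
  by apply: supp_sub hpq => u v /eqP.
have hw' := @supp_homog_divr k n 2 _ bideg (wtg, 1) (pred1 (p, q)) g w
  bidegD koszul_neq0 koszul_homog hpq'.
apply: suppM x1_exp_homog hw' => u v u' v' hu /eqP hu'.
rewrite bidegD hu; case: (bideg u' v') hu' => p' q' [<- <-].
by rewrite dg; congr pair; rewrite /=; lia.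
Qed.

Variable h : 'X_{1..n} -> S.
Hypothesis delta_or_e : delta = 0%N \/ e = 0%N.
Hypothesis phi_h : forall m, mdeg m = e -> phi a (h m) = mon m 0%MM * g.

Local Notation H := (fun F => exists2 m, mdeg m = e & F = h m).

(** Splits off the factor x^m that the image x^m g of a form h absorbs. Enough factors x_i exist: if
    delta = 0 the weight is at least e, and otherwise e = 0. *)
Lemma split_monomial u v : - wtg <= wt a u v -> exists m u',
  [/\ mdeg m = e, u = (m + u')%MM & - delta%:Z <= wt a u' v].
Proof.
move=> le_w; have le_e : (e <= mdeg u)%N.
  by case: delta_or_e => h0; move: le_w; rewrite delta_e h0 /wt; lia.
have [|m [_ le_mu dm]] := @mnm_between _ 0%MM u e (lem1m u); first by rewrite mdeg0.
exists m, (u - m)%MM; rewrite addmC submK //; split=> //.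
by move: le_w; rewrite delta_e -{1}(submK le_mu) -{1}[v]addm0 wtD wt0r dm; lia.
Qed.

Lemma eq_x1_ARM y : elt_mul (x1 ^+ delta) ARM y <->
  exists2 w, y = x1 ^+ delta * (g * w) & Wt (- wtg) w.
Proof.
split=> [[_ /ARM_P[w -> hw] ->]|[w -> hw]]; first by exists w.
by exists (g * w) => //; apply/ARM_P; exists w.
Qed.

(** Both sides consist of the elements x_1^delta g w with w of weight >= e - delta. Termwise, x^m
    goes to g and what remains, times x_1^delta, lies in the symbolic power. *)
Lemma x1_ARM_eq y : elt_mul (x1 ^+ delta) ARM y <->
  ideal_mul (ReesM a) (ideal_gen (ReesM a) (image_of (phi a) H)) Symb y.
Proof.
rewrite eq_x1_ARM; split=> [[w -> hw]|].
  apply: (@nested_ind _ _ _ (fun w => ideal_mul _ _ _ (x1 ^+ delta * (g * w)))).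
  - by rewrite !mulr0; apply: ideal_gen0.
  - by move=> w1 w2 h1 h2; rewrite !mulrDr; apply: ideal_genD.
  move=> u v /hw/split_monomial[m [u' [dm def_u hu']]].
  have -> : x1 ^+ delta * (g * (scal w@_v@_u * mon u v)) =
      1 * ((1 * phi a (h m)) * (x1 ^+ delta * (scal w@_v@_u * mon u' v))).
    have -> : mon u v = mon m 0%MM * mon u' v :> Rt by rewrite monM add0m -def_u.
    rewrite (phi_h dm).
    move: (x1 ^+ delta) g (scal _) (mon m _) (mon u' v) => x g' c m' u''; ring.
  apply: ideal_gen_mem; first exact: ReesM1.
  exists (1 * phi a (h m)), (x1 ^+ delta * (scal w@_v@_u * mon u' v)); split.
  - apply: ideal_gen_mem; first exact: ReesM1.
    by exists (h m) => //; exists m.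
  - by apply/Symb_P; exists (scal w@_v@_u * mon u' v) => //; apply: supp_term.
  by [].
pose K y := exists2 w, y = x1 ^+ delta * (g * w) & Wt (- wtg) w.
have K0 : K 0 by exists 0; [rewrite !mulr0 | exact: supp0].
have KD y1 y2 : K y1 -> K y2 -> K (y1 + y2).
  by move=> [w1 -> h1] [w2 -> h2]; exists (w1 + w2); [rewrite !mulrDr | exact: suppD].
move: y; apply: (@ideal_gen_min _ _ _ K K0 KD) => r _ hr [u [_ [hu /Symb_P[z -> hz] ->]]].
pose V s := K (r * (s * (x1 ^+ delta * z))).
suff hV s : ideal_gen (ReesM a) (image_of (phi a) H) s -> V s by exact: hV.
move: s; apply: ideal_gen_min.
- by rewrite /V mul0r mulr0.
- by move=> u1 u2 h1 h2; rewrite /V mulrDl mulrDr; apply: KD.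
move=> r' _ hr' [_ [m dm ->] ->]; rewrite /V; exists (r * r' * mon m 0%MM * z).
  rewrite (phi_h dm); move: (x1 ^+ delta) g (mon m _) => x g' m'; ring.
apply: (@Wt_weak (0 + 0 + e%:Z - delta%:Z)); first by rewrite delta_e; lia.
apply: WtM hz; apply: WtM; last by rewrite -dm -(wt0r a); apply: Wt_mon.
by apply: WtM; apply/ReesM_Wt.
Qed.

Lemma x1_ARM_eq0 y : e = 0%N -> elt_mul (x1 ^+ delta) ARM y <->
  elt_mul (phi a (h 0%MM)) Symb y.
Proof.
move=> e0; have -> : phi a (h 0%MM) = g by rewrite phi_h ?mdeg0 // mon0 mul1r.
have dg : wtg = delta by rewrite delta_e e0 subr0.
rewrite eq_x1_ARM; split=> [[w -> hw]|[_ /Symb_P[w -> hw] ->]].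
  exists (x1 ^+ delta * w); last by rewrite mulrCA.
  by apply/Symb_P; exists w => //; rewrite -dg.
by exists w; [rewrite mulrCA | rewrite dg].
Qed.

(** Since delta = 0, the cofactors of x^m g in phi F have nonnegative weight and lift to S. This
    gives G in the ideal with the same image as F, and F - G lies in ker phi = I_2(C). *)
Lemma ker_chi_P F : delta = 0%N -> ker_chi a f F <->
  ideal_gen (@whole _) (fun G => is_minor 2 (Cmx k n a) G \/ H G) F.
Proof.
move=> delta0; split=> [hF|].
  suff [G hG phiG] : exists2 G, ideal_gen (@whole _)
      (fun G => is_minor 2 (Cmx k n a) G \/ H G) G & phi a G = phi a F.
    have FG : I2 (F - G) by apply: (ker_phi n_gt1); rewrite phiB phiG subrr.
    rewrite -[F](subrK G); apply: ideal_genD hG.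
    move: (F - G) FG; apply: ideal_gen_min => [|F1 F2|r F1 _ hF1].
    - exact: ideal_gen0.
    - exact: ideal_genD.
    by apply: ideal_gen_mem; [|left].
  have /ARM_P[w -> hw] : ARM (phi a F) by exists F.
  apply: (@nested_ind _ _ _ (fun w => exists2 G, _ G & _ = g * w)).
  - by exists 0; [exact: ideal_gen0 | rewrite phi0 mulr0].
  - move=> w1 w2 [G1 h1 e1] [G2 h2 e2]; exists (G1 + G2); first exact: ideal_genD.
    by rewrite phiD e1 e2 mulrDr.
  move=> u v /hw/split_monomial[m [u' [dm def_u hu']]].
  have [tau [xi [du dv]]] : exists tau xi, xdeg tau xi = u' /\ tdeg tau = v.
    by apply: (phi_mon_surj n_gt0); move: hu'; rewrite delta0; lia.
  exists (scal w@_v@_u * mon tau xi * h m); first by apply: ideal_gen_mem; [|right; exists m].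
  rewrite 2!phiM phi_scal phi_mon du dv (phi_h dm).
  have -> : mon u v = mon m 0%MM * mon u' v :> Rt by rewrite monM add0m -def_u.
  move: g (scal _) (mon m _) (mon u' v) => g' c m' u''; ring.
have chiD F1 F2 : chi a f (F1 + F2) = chi a f F1 + chi a f F2.
  by rewrite /chi phiD PsiD.
have chiM F1 F2 : chi a f (F1 * F2) = chi a f F1 * chi a f F2.
  by rewrite /chi phiM PsiM.
have chi0 : chi a f 0 = 0 by rewrite /chi phi0 Psi0.
rewrite /ker_chi.
move: F; apply: ideal_gen_min.
- exact: chi0.
- by move=> F1 F2 h1 h2; rewrite chiD h1 h2 addr0.
move=> r F1 _ h1; rewrite chiM; suff -> : chi a f F1 = 0 by rewrite mulr0.
case: h1 => [hF1|[m dm ->]].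
  by rewrite /chi (phi_I2 n_gt1 (whole_ideal_gen_mem hF1)) Psi0.
by rewrite /chi (phi_h dm) PsiM Psi_koszul mulr0.
Qed.

End Koszul.

Lemma phi_R_to_S (k : fieldType) n (a : 'I_2 -> nat) (u : {mpoly k[n]}) :
  phi a (R_to_S a u) = u%:MP.
Proof.
rewrite [u]mpolyE /R_to_S !rmorph_sum phi_sum; apply: eq_bigr => m _.
rewrite -mul_mpolyC !rmorphM /= map_mpolyC map_mpolyX phiM.
have -> : ('X_[m] : {mpoly {mpoly k[#|Tidx n a|]}[n]}) = mon 0%MM m.
  by rewrite /mon mpolyX0 mpolyC1 mul1r.
rewrite -/(scal u@_m) phi_scal phi_mon xdegx tdeg0 /mon mpolyX0 mulr1.
by [].
Qed.

(** The defining relations of b and c turn the two sums into m f_1 and m f_2, so that the image is m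
    g. *)
Lemma phi_hform (k : fieldType) n (a : 'I_2 -> nat) c b :
  phi a (hform a c b) =
    (\sum_kk b kk * 'X_[k, jmon kk])%:MP * 'X_ord_max
    - (\sum_kk c kk * 'X_[k, jmon kk])%:MP * 'X_ord0 :> {mpoly {mpoly k[n]}[2]}.
Proof.
have term l (w : Jset n (a l) -> {mpoly k[n]}) :
    phi a (\sum_kk R_to_S a (w kk) * Tvar k (Tagged (fun l => Jset n (a l)) kk)) =
    (\sum_kk w kk * 'X_[jmon kk])%:MP * 'X_l.
  rewrite phi_sum rmorph_sum mulr_suml; apply: eq_bigr => kk _.
  rewrite phiM phi_R_to_S TvarE phi_mon xdegT tdegT /jmonT /tagT enum_rankK /=.
  by rewrite rmorphM /= -mulrA.
by rewrite /hform phiD phiN !term addrC.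
Qed.

Theorem theorem3p11 (k : fieldType) (n : nat) (hn : (2 <= n)%N)
  (f1 f2 : {mpoly k[n]}) (d1 d2 d : nat)
  (hreg : regular_sequence [:: f1; f2])
  (hf1 : f1 \is d1.-homog) (hf2 : f2 \is d2.-homog)
  (hd21 : (d2 <= d1)%N) (hd1 : (d1 <= d)%N)
  (* For d <= d1 + d2 the only m below is 1; for d >= d1 + d2 the coefficients
     have degree 0. *)
  (c : 'X_{1..n} -> Jset n (d - d1) -> {mpoly k[n]})
  (b : 'X_{1..n} -> Jset n (d - d2) -> {mpoly k[n]})
  (hc : forall m kk, mdeg m = (d - (d1 + d2))%N ->
          c m kk \is (d1 + d2 - d).-homog)
  (hb : forall m kk, mdeg m = (d - (d1 + d2))%N ->
          b m kk \is (d1 + d2 - d).-homog)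
  (hcf : forall m, mdeg m = (d - (d1 + d2))%N ->
          'X_[m] * f2 = \sum_kk c m kk * 'X_[jmon kk])
  (hbf : forall m, mdeg m = (d - (d1 + d2))%N ->
          'X_[m] * f1 = \sum_kk b m kk * 'X_[jmon kk]) :
  let a := pair2 (d - d1)%N (d - d2)%N in
  let f := pair2 f1 f2 in
  (* max(d1 + d2 - d, 0), which implements the convention on exponents *)
  let delta := (d1 + d2 - d)%N in
  let RM := @ReesM k n a in
  let RI := ReesI (truncation (ideal_gen (@whole _) (fun y => y \in [:: f1; f2])) d) in
  let A := ker_chi a f in
  let ARM := image_of (phi a) A in
  let L := @Lideal k n a in
  let x1 := phi a (xvar k a (Ordinal (ltnW hn))) in
  let h := fun m => hform a (c m) (b m) in
  let H := fun F => exists2 m, mdeg m = (d - (d1 + d2))%N & F = h m in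
  [/\ forall y, elt_mul (x1 ^+ delta) ARM y <->
        ideal_mul RM (ideal_gen RM (image_of (phi a) H))
          (symbolic_power RM L delta) y,
      (d <= d1 + d2 - 1)%N ->
        (forall y, elt_mul (x1 ^+ delta) ARM y <->
           elt_mul (phi a (h 0%MM)) (symbolic_power RM L delta) y)
        /\ bigraded_iso a ARM (symbolic_power RM L delta) 0 (-1)
    & (d1 + d2 <= d)%N ->
        (forall y, RI y <-> exists F, chi a f F = y)
        /\ (forall F, A F <->
              ideal_gen (@whole _)
                (fun G => is_minor 2 (Cmx k n a) G \/ H G) F)].
Proof.
move=> a f delta RM RI A ARM L x1' h H.
(* If f_1 were 0, regularity of the first element would put 1 in the zero ideal. *)
have f0_neq0 : f ord0 <> 0.
  move=> f10; have {}f10 : f1 = 0 := f10.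
  have : ideal_gen (@whole _) (fun y => y \in take 0 [:: f1; f2]) 1.
    apply: (hreg.1 0%N isT); rewrite /= f10 mul0r; exact: ideal_gen0.
  suff none y : ideal_gen (@whole {mpoly k[n]}) (fun y => y \in [::]) y -> y = 0.
    by move=> /none/eqP; apply/negP/oner_neq0.
  by move: y; apply: ideal_gen_min => // y z -> ->; rewrite addr0.
have f1_reg w : (exists w', f ord_max * w = w' * f ord0) -> exists w', w = w' * f ord0.
  by move=> /principal_idealP/(hreg.1 1%N isT)/principal_idealP.
pose df := pair2 d1 d2.
have f_homog l : f l \is (df l).-homog by case: (ord2P l) => ->.
have a_df l : (a l + df l)%N = d.
  by case: (ord2P l) => ->; rewrite /a /df /pair2 /= subnK // (leq_trans hd21).
pose e := (d - (d1 + d2))%N.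
(* The truncated differences delta and e are the positive and negative parts of d1 + d2 - d, so one
   of them vanishes. *)
have delta_e : wtg df d = delta%:Z - e%:Z by rewrite /wtg /df /pair2 /= /delta /e; lia.
have delta_or_e : delta = 0%N \/ e = 0%N by rewrite /delta /e; lia.
have phi_h m : mdeg m = e -> phi a (h m) = mon m 0%MM * koszul f.
  move=> dm; rewrite phi_hform -(hcf m dm) -(hbf m dm) /koszul /mon mpolyX0 mulr1.
  by rewrite mulrBr !mulrA -!mpolyCM.
rewrite /x1' phi_x1; split.
- move=> y; exact: (x1_ARM_eq hn f0_neq0 f1_reg f_homog a_df delta_e delta_or_e phi_h).
(* If d1 + d2 = 0, the truncated bound reads d <= 0 and e = 0 still holds. *)
- move=> le_d; have e0 : e = 0%N by rewrite /e; lia.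
  split=> [y|].
    exact: (x1_ARM_eq0 hn f0_neq0 f1_reg f_homog a_df delta_e phi_h y e0).
  exact: (ARM_iso hn f0_neq0 f1_reg f_homog a_df delta_e e0).
move=> le_d; have delta0 : delta = 0%N by rewrite /delta; lia.
split=> [y|F].
  exact: (ReesI_P hn f_homog a_df).
exact: (ker_chi_P hn f0_neq0 f1_reg f_homog a_df delta_e delta_or_e phi_h).
Qed.
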